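(* The following problem is undecidable: given finite alphabets $A,B$ and a timed automaton recognising (with Büchi acceptance) a timed $\omega$-language $W\subseteq(A\times B\times\mathbb R_{\ge0})^\omega$ over $A\times B$, decide whether there exist $k,m\in\mathbb N$ such that Player II has a winning $k,m$-controller in the timed synthesis game $G(A,B,W)$. This remains undecidable when the input automaton for $W$ is restricted to have one clock and no $\varepsilon$-transitions.
   Context: Timed words: sequences $(a_1,t_1)(a_2,t_2)\cdots$ with $0\le t_1\le t_2\le\cdots$ reals. Clock constraints over clocks $X$: Boolean combinations of $x\sim z$, $x-y\sim z$ ($z\in\mathbb Z$, $\sim\in\{<,\le,=,\ge,>\}$). A timed automaton (possibly with $\varepsilon$-transitions) $(\Sigma,L,X,I,F,\Delta)$ has rules $(p,a,\varphi,Y,q)$, $a\in\Sigma\cup\{\varepsilon\}$, taken after time elapse when the valuation satisfies $\varphi$, resetting $Y$; runs start in $I$ with all clocks $0$; its timed $\omega$-language consists of infinite timed words over $\Sigma$ obtained by deleting $\varepsilon$-letters from words of runs visiting $F$ infinitely often. Regions: for clocks $X$ and $m$, valuations are equivalent if they satisfy the same constraints over $X$ with constants of absolute value $\le m$. Game $G(A,B,W)$: in rounds Player I picks $a_i\in A$, $t_i\ge t_{i-1}$ ($t_0=0$), Player II answers $b_i\in B$; Player I wins iff $(a_1,b_1,t_1)(a_2,b_2,t_2)\cdots\in W$. A $k,m$-controller is $(A,B,L,\ell_0,\delta)$ with finite $L$, $k$ clocks $X$, $\delta:L\times A\times\mathrm{Regions}(X,m)\to L\times B\times 2^X$; from $(\ell_n,\mu_n)$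 (initially $\ell_0$ and all clocks $0$), on $(a_{n+1},t_{n+1})$, with $\nu=\mu_n+(t_{n+1}-t_n)$ and $\delta(\ell_n,a_{n+1},[\nu])=(\ell',b,Y)$, it answers $b$ and moves to $\ell'$ and $\nu$ with $Y$ reset to $0$. It is winning if no consistent infinite play lies in $W$. *)

(* Defs.v *)
From mathcomp Require Import all_boot.
From mathcomp Require Import ssrint.
From Stdlib Require Import Reals.

Set Implicit Arguments.
Unset Strict Implicit.
Unset Printing Implicit Defensive.

Inductive instr := INC (r : nat) | DEC (r : nat) (j : nat).
Definition program := seq instr.
Definition config := (nat * (nat -> nat))%type.

Definition update (regs : nat -> nat) (r v : nat) : nat -> nat :=
  fun x => if x == r then v else regs x.

Definition step (p : program) (c : config) : config :=
  let: (pc, regs) := c in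
  if (pc < size p)%N then
    match nth (INC 0) p pc with
    | INC r => (pc.+1, update regs r (regs r).+1)
    | DEC r j => if regs r is n.+1 then (pc.+1, update regs r n) else (j, regs)
    end
  else c.

Definition init_config (n : nat) : config := (0, fun r => if r == 0 then n else 0).

Definition halts_with (p : program) (n out : nat) : Prop :=
  exists k, let c := iter k (step p) (init_config n) in
            (size p <= c.1)%N /\ c.2 0 = out.

Definition cm_decidable_on (T : countType) (D : T -> Prop) (P : T -> Prop) : Prop :=
  exists p : program, forall x : T, D x ->
    (P x -> halts_with p (pickle x) 1) /\ (~ P x -> halts_with p (pickle x) 0).

Definition cm_decidable (T : countType) (P : T -> Prop) : Prop :=
  cm_decidable_on (fun _ : T => True) P.

(* comparison operators: 0 : <, 1 : <=, 2 : =, 3 : >=, 4 : > *)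
Definition cmp := 'I_5.

(* atom (x, None, op, z)   is   x op z
   atom (x, Some y, op, z) is   x - y op z       (clocks are nats) *)
Definition atom := (nat * option nat * cmp * int)%type.

(* clock constraints: Boolean combinations of atoms, given in
   disjunctive normal form (every Boolean combination of atoms is
   equivalent to one, since negated atoms are disjunctions of atoms) *)
Definition guard := seq (seq atom).

(* label: None = epsilon, Some (a, b) = letter (a, b) of A x B,
   letters of A = {0..nA-1}, of B = {0..nB-1} *)
Definition label := option (nat * nat).

Definition transition := (nat * label * guard * seq nat * nat)%type.

(* (initial locations, final locations, rules); locations and clocks
   are the (finitely many) naturals mentioned *)
Definition TA := (seq nat * seq nat * seq transition)%type.

(* problem instance: (|A|, |B|, automaton over A x B) *)
Definition instance := (nat * nat * TA)%type.

Definition tr_src (t : transition) : nat := let: (s, _, _, _, _) := t in s.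
Definition tr_label (t : transition) : label := let: (_, l, _, _, _) := t in l.
Definition tr_guard (t : transition) : guard := let: (_, _, g, _, _) := t in g.
Definition tr_reset (t : transition) : seq nat := let: (_, _, _, Y, _) := t in Y.
Definition tr_tgt (t : transition) : nat := let: (_, _, _, _, q) := t in q.

Definition int_to_R (z : int) : R :=
  match z with Posz n => INR n | Negz n => Ropp (INR n.+1) end.

Definition cmp_sat (op : cmp) (x y : R) : Prop :=
  match val op with
  | 0 => Rlt x y | 1 => Rle x y | 2 => x = y | 3 => Rge x y | _ => Rgt x y
  end.

Definition atom_sat (v : nat -> R) (a : atom) : Prop :=
  let: (i, oj, op, z) := a in
  cmp_sat op (Rminus (v i) (match oj with Some j => v j | None => R0 end))
          (int_to_R z).

Definition guard_sat (v : nat -> R) (g : guard) : Prop :=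
  exists2 c, c \in g & forall a, a \in c -> atom_sat v a.

Definition prev_time (T : nat -> R) (n : nat) : R :=
  if n is n'.+1 then T n' else R0.

Definition delay (v : nat -> R) (d : R) : nat -> R := fun x => Rplus (v x) d.

Definition reset (Y : seq nat) (v : nat -> R) : nat -> R :=
  fun x => if x \in Y then R0 else v x.

(* An infinite run: step n takes rule tr n from loc n to loc n.+1 at
   time T n (after letting time elapse from the previous step, or
   from 0); v n is the clock valuation before step n. *)
Definition is_run (A : TA) (loc : nat -> nat) (tr : nat -> transition)
    (T : nat -> R) (v : nat -> nat -> R) : Prop :=
  let: (Init, Fin, D) := A in
  [/\ loc 0 \in Init, v 0 = (fun _ => R0), Rle R0 (T 0) &
  forall n,
    let nu := delay (v n) (Rminus (T n) (prev_time T n)) in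
    [/\ Rle (T n) (T n.+1), tr n \in D,
        tr_src (tr n) = loc n /\ tr_tgt (tr n) = loc n.+1,
        guard_sat nu (tr_guard (tr n)) &
        v n.+1 = reset (tr_reset (tr n)) nu]].

Definition buchi (A : TA) (loc : nat -> nat) : Prop :=
  let: (Init, Fin, D) := A in forall N, exists2 n, (N <= n)%N & loc n \in Fin.

Definition tword := nat -> ((nat * nat) * R)%type.

Definition erases_to (tr : nat -> transition) (T : nat -> R) (w : tword) : Prop :=
  exists idx : nat -> nat,
    [/\ forall n, (idx n < idx n.+1)%N,
        forall n, tr_label (tr (idx n)) = Some (w n).1 /\ (w n).2 = T (idx n) &
        forall m, tr_label (tr m) <> None -> exists n, idx n = m].

Definition accepts (A : TA) (w : tword) : Prop :=
  exists loc tr T v, [/\ is_run A loc tr T v, buchi A loc & erases_to tr T w].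

Definition csat (k : nat) (nu : 'I_k -> R) (x : 'I_k) (y : option 'I_k)
    (op : cmp) (z : int) : Prop :=
  cmp_sat op (Rminus (nu x) (match y with Some y' => nu y' | None => R0 end))
          (int_to_R z).

(* valuations are region-equivalent for (X = 'I_k, m): they satisfy the
   same constraints with constants of absolute value <= m (it suffices
   to test atomic constraints) *)
Definition region_equiv (k m : nat) (nu nu' : 'I_k -> R) : Prop :=
  forall (x : 'I_k) (y : option 'I_k) (op : cmp) (z : int), (absz z <= m)%N ->
    (csat nu x y op z <-> csat nu' x y op z).

(* a k,m-controller: delta is given on valuations and required to be
   constant on regions, i.e. it is a function on Regions(X, m) *)
Record controller (nA nB k m : nat) := Controller {
  c_loc : finType;
  c_init : c_loc;
  c_delta : c_loc -> 'I_nA -> ('I_k -> R) -> (c_loc * 'I_nB * {set 'I_k})%type;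
  c_delta_region : forall l a nu nu', region_equiv m nu nu' ->
                     c_delta l a nu = c_delta l a nu' }.

(* state (l_n, mu_n) before round n (0-based) when Player I plays
   letters a and times t *)
Fixpoint ctrl_state nA nB k m (C : controller nA nB k m)
    (a : nat -> 'I_nA) (t : nat -> R) (n : nat) : (c_loc C * ('I_k -> R))%type :=
  match n with
  | 0 => (c_init C, fun _ => R0)
  | n'.+1 =>
      let: (l, mu) := ctrl_state C a t n' in
      let nu := fun x => Rplus (mu x) (Rminus (t n') (prev_time t n')) in
      let: (l', _, Y) := @c_delta _ _ _ _ C l (a n') nu in
      (l', fun x => if x \in Y then R0 else nu x)
  end.

Definition ctrl_answer nA nB k m (C : controller nA nB k m)
    (a : nat -> 'I_nA) (t : nat -> R) (n : nat) : 'I_nB :=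
  let: (l, mu) := ctrl_state C a t n in
  let nu := fun x => Rplus (mu x) (Rminus (t n) (prev_time t n)) in
  (@c_delta _ _ _ _ C l (a n) nu).1.2.

Definition winning nA nB k m (C : controller nA nB k m) (W : tword -> Prop) : Prop :=
  forall (a : nat -> 'I_nA) (t : nat -> R),
    Rle R0 (t 0) -> (forall n, Rle (t n) (t n.+1)) ->
    ~ W (fun n => ((val (a n), val (ctrl_answer C a t n)), t n)).

Definition synth_problem (x : instance) : Prop :=
  let: (nA, nB, A) := x in
  exists (k m : nat) (C : controller nA nB k m), winning C (accepts A).

Definition atom_one_clock (a : atom) : Prop :=
  let: (i, oj, _, _) := a in i = 0 /\ (oj = None \/ oj = Some 0).

Definition one_clock_no_eps (x : instance) : Prop :=
  let: (_, _, (_, _, D)) := x in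
  forall t, t \in D ->
    [/\ tr_label t <> None,
        forall i, i \in tr_reset t -> i = 0 &
        forall c a, c \in tr_guard t -> a \in c -> atom_one_clock a].

(* Main.v *)
(** Player I drives a lossy counter machine in the style of Mayr: every round of the play lasts one
    time unit and re-enacts the tokens of the previous round exactly one time unit later, and
    Player II has to say whether the claimed predecessor of each event exists.  A wrong answer is
    recognised by a one-clock automaton that guesses the predecessor.  Player I may lose tokens,
    but a new token is granted only when a simulation of a counter machine [q] on input [n] has used
    up all free tokens; since a loss costs one token, the number of tokens stays bounded when the
    registers of [q] do.  In that case one clock per token lets a controller answer correctly.
    Otherwise Player I builds up more tokens than there are clocks, and by pigeonhole some clock
    valuation cannot tell an event from one that comes slightly too late.

    The input [n] occurs in a single guard [x = n] (it fixes the number of rounds in which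
    register 0 is loaded), hence the code of the instance is a simple function of [n] and of the
    code [c] of the remaining rules.  Given a decider [p], let [q] on input [c] compute the code of
    the instance with [n = c], run [p] on it, and halt or grow forever against its answer. *)

From HB Require Import structures.
Require Import Defs.
From mathcomp Require Import all_boot.
From mathcomp Require Import ssrint zify.
From Stdlib Require Import Reals Lra FunctionalExtensionality.

Set Implicit Arguments.
Unset Strict Implicit.
Unset Printing Implicit Defensive.

(** * Register machines *)

(** A one-clock automaton cannot see that nothing happened one time unit ago; it can only compare a
    guessed event with the one that follows exactly one unit later. Hence the blank events: in the
    spoiling play each token is followed by a blank, so an event that comes one grid step late has a
    blank as its exact predecessor, and silence about its claim is refuted by a mismatch of tokens.
    Every rule labelled with an objection leads to the accepting sink. So a correct objection leaves
    the automaton without a run and decides the play for Player II, a wrong one decides it for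
    Player I, and the Büchi condition is in effect a reachability condition. The self-reference
    needs no recursion theorem: the code of the instance depends on [q], but [q] meets it only
    through its input, the number that also stands in the guard. What remains circular is that the
    alphabet and the location codes depend on the number of registers of [q]; this number is
    therefore fixed from [p] and a depth bound alone, before the expression for the code is
    known. *)

Definition regs := nat -> nat.

Definition run_sum (R : nat) (q : program) (n k : nat) : nat :=
  \sum_(r < R) (iter k (step q) (init_config n)).2 r.

Definition bounded_run R q n := exists B, forall k, run_sum R q n k <= B.
Definition unbounded_run R q n := forall B, exists k, B < run_sum R q n k.

Definition instr_reg (i : instr) : nat :=
  match i with INC r => r | DEC r _ => r end.

Definition uses_regs (R : nat) : program -> bool := all (fun i => instr_reg i < R).

(* [Loop r c] is [while r > 0 do (r--; c)]. *)
Inductive cmd := Skip | Inc of nat | Seq of cmd & cmd | Loop of nat & cmd.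

Inductive exec : cmd -> regs -> regs -> Prop :=
| ExecSkip s : exec Skip s s
| ExecInc r s : exec (Inc r) s (update s r (s r).+1)
| ExecSeq c1 c2 s1 s2 s3 : exec c1 s1 s2 -> exec c2 s2 s3 -> exec (Seq c1 c2) s1 s3
| ExecLoop0 r c s : s r = 0 -> exec (Loop r c) s s
| ExecLoopS r c s1 s2 s3 m : s1 r = m.+1 -> exec c (update s1 r m) s2 ->
    exec (Loop r c) s2 s3 -> exec (Loop r c) s1 s3.

Fixpoint csize (c : cmd) : nat :=
  match c with
  | Skip => 0
  | Inc _ => 1
  | Seq c1 c2 => csize c1 + csize c2
  | Loop _ c => (csize c).+2
  end.

(* [z] is a register that stays zero, so that [DEC z j] is an unconditional jump. *)
Fixpoint compile (z off : nat) (c : cmd) : program :=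
  match c with
  | Skip => [::]
  | Inc r => [:: INC r]
  | Seq c1 c2 => compile z off c1 ++ compile z (off + csize c1) c2
  | Loop r c => DEC r (off + (csize c).+2) :: rcons (compile z off.+1 c) (DEC z off)
  end.

Fixpoint cmd_regs (P : pred nat) (c : cmd) : bool :=
  match c with
  | Skip => true
  | Inc r => P r
  | Seq c1 c2 => cmd_regs P c1 && cmd_regs P c2
  | Loop r c => P r && cmd_regs P c
  end.

Lemma size_compile z off c : size (compile z off c) = csize c.
Proof.
elim: c off => //= [c1 IH1 c2 IH2|r c IH] off; first by rewrite size_cat IH1 IH2.
by rewrite size_rcons IH.
Qed.

Lemma uses_compile R z off c :
  z < R -> cmd_regs (fun r => r < R) c -> uses_regs R (compile z off c).
Proof.
move=> zR; elim: c off => //= [r|c1 IH1 c2 IH2|r c IH] off; first by rewrite andbT.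
  by case/andP=> /IH1 h1 /IH2 h2; rewrite /uses_regs all_cat; apply/andP; split; [exact: h1|exact: h2].
by case/andP=> rR h; rewrite /uses_regs /= all_rcons /= zR rR; apply: IH.
Qed.

Definition reaches (q : program) (c c' : config) : Prop := exists k, iter k (step q) c = c'.

Lemma reaches_refl q c : reaches q c c. Proof. by exists 0. Qed.

Lemma reaches_trans q c1 c2 c3 : reaches q c1 c2 -> reaches q c2 c3 -> reaches q c1 c3.
Proof. by move=> [k <-] [l <-]; exists (l + k); rewrite iterD. Qed.

Lemma reaches_step q c c' : step q c = c' -> reaches q c c'.
Proof. by exists 1. Qed.

Lemma exec_zero z c s s' : exec c s s' -> cmd_regs (fun r => r != z) c -> s z = 0 -> s' z = 0.
Proof.
elim=> {c s s'} //= [r s|c1 c2 s1 s2 s3 _ IH1 _ IH2|r c s1 s2 s3 m _ _ IH1 _ IH2].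
- by rewrite /update eq_sym => /negbTE->.
- by case/andP=> /IH1 h1 /IH2 h2 /h1 /h2.
- move=> /[dup] h /andP[rz hc] hz; apply: IH2 => //; apply: IH1 => //.
  by rewrite /update eq_sym (negbTE rz).
Qed.

Lemma nth_cat_cons (T : Type) (x0 : T) s1 x s2 : nth x0 (s1 ++ x :: s2) (size s1) = x.
Proof. by rewrite nth_cat ltnn subnn. Qed.

(** Jump targets are absolute, and the induction on the execution enters subprograms whose
    surroundings grow; hence the arbitrary context [pre], [post] and the offset [size pre]. *)
Lemma compile_correct z c s s' pre post :
  exec c s s' -> cmd_regs (fun r => r != z) c -> s z = 0 ->
  reaches (pre ++ compile z (size pre) c ++ post) (size pre, s) (size pre + csize c, s').
Proof.
move=> H; elim: H pre post => {c s s'} /=.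
- by move=> s pre post _ _; rewrite addn0; apply: reaches_refl.
- move=> r s pre post rz sz; apply: reaches_step; rewrite /step.
  by rewrite size_cat /= nth_cat_cons addnS ltnS leq_addr addn1.
- move=> c1 c2 s1 s2 s3 e1 IH1 e2 IH2 pre post /andP[h1 h2] sz.
  apply: (@reaches_trans _ _ (size pre + csize c1, s2)).
    by rewrite -catA; apply: IH1.
  have /= := IH2 (pre ++ compile z (size pre) c1) post h2 (exec_zero e1 h1 sz).
  by rewrite size_cat size_compile -!catA addnA.
- move=> r c s sr pre post _ _; apply: reaches_step.
  by rewrite /step size_cat /= nth_cat_cons sr addnS ltnS leq_addr.
- move=> r c s1 s2 s3 m sr e1 IH1 e2 IH2 pre post /[dup] hrc /andP[rz hc] sz.
  set q := (X in reaches X).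
  have uz : update s1 r m z = 0 by rewrite /update eq_sym (negbTE rz).
  apply: (@reaches_trans _ _ ((size pre).+1, update s1 r m)).
    apply: reaches_step.
    by rewrite /step size_cat /= nth_cat_cons sr addnS ltnS leq_addr.
  apply: (@reaches_trans _ _ ((size pre).+1 + csize c, s2)).
    have := IH1 (rcons pre (DEC r (size pre + (csize c).+2))) (DEC z (size pre) :: post) hc uz.
    by rewrite size_rcons cat_rcons /q /= cat_rcons.
  apply: (@reaches_trans _ _ (size pre, s2)); last exact: IH2 (exec_zero e1 hc uz).
  have nq : nth (INC 0) q ((size pre).+1 + csize c) = DEC z (size pre).
    rewrite /q /= cat_rcons -cat_cons catA.
    suff -> : (size pre).+1 + csize c =
      size (pre ++ DEC r (size pre + (csize c).+2) :: compile z (size pre).+1 c).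
      by rewrite nth_cat_cons.
    by rewrite size_cat /= size_compile addnS.
  apply: reaches_step; rewrite /step nq (exec_zero e1 hc uz) ifT //.
  by rewrite /q size_cat /= size_cat size_rcons size_compile; lia.
Qed.

Lemma exec_loop (r : nat) c (I : nat -> regs -> Prop) m s :
  (forall m s, I m s -> s r = m) ->
  (forall m s, I m.+1 s -> exists2 s', exec c (update s r m) s' & I m s') ->
  I m s -> exists2 s', exec (Loop r c) s s' & I 0 s'.
Proof.
move=> Ir Istep; elim: m s => [|m IH] s Is.
  by exists s => //; apply: ExecLoop0; apply: Ir.
have [s1 e1 /IH[s2 e2 I2]] := Istep _ _ Is.
by exists s2 => //; apply: ExecLoopS e1 e2; apply: Ir.
Qed.

(* The pairing function underlying [pickle] on sequences and pairs. *)
Definition node (a b : nat) : nat := expn 2 a * b.*2.+1.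

(** * Expressions over the pairing function and loop programs that evaluate them *)

Inductive expr := EConst of nat | EVar | ENode of expr & expr.

Fixpoint eval (n : nat) (e : expr) : nat :=
  match e with
  | EConst c => c
  | EVar => n
  | ENode e1 e2 => node (eval n e1) (eval n e2)
  end.

(** How far above its destination register [expr_cmd] reaches; the scratch register of a copy and
    the two extra registers of [node_cmd] are included. *)
Fixpoint edepth (e : expr) : nat :=
  match e with
  | EConst _ => 0
  | EVar => 1
  | ENode e1 e2 => maxn (maxn (edepth e1) (edepth e2).+1) 2
  end.

Definition move_cmd (a b : nat) := Loop a (Inc b).

Definition copy_cmd (x d t : nat) :=
  Seq (Loop x (Seq (Inc d) (Inc t))) (move_cmd t x).

(** Builds 2b+1 in [t], doubles it [a] times with the emptied [b] as scratch, and moves the result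
    to [a]. *)
Definition node_cmd (a b t : nat) :=
  Seq (Seq (Loop b (Seq (Inc t) (Inc t))) (Inc t))
      (Seq (Loop a (Seq (Loop t (Seq (Inc b) (Inc b))) (move_cmd b t))) (move_cmd t a)).

Fixpoint expr_cmd (x d : nat) (e : expr) : cmd :=
  match e with
  | EConst c => iter c (Seq (Inc d)) Skip
  | EVar => copy_cmd x d d.+1
  | ENode e1 e2 =>
      Seq (expr_cmd x d e1) (Seq (expr_cmd x d.+1 e2) (node_cmd d d.+1 d.+2))
  end.

Lemma expr_cmd_regs (P : pred nat) x d e :
  P x -> (forall r, d <= r <= d + edepth e -> P r) -> cmd_regs P (expr_cmd x d e).
Proof.
move=> Px; elim: e d => [c|/=|e1 IH1 e2 IH2 /=] d Pd.
- have Pd' : P d by apply: Pd; rewrite /= addn0 leqnn.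
  by rewrite /=; elim: c {Pd} => //= c IH; rewrite Pd' IH.
- by rewrite Px !Pd //; lia.
- rewrite IH1 ?IH2 /=; first by rewrite !Pd //; lia.
  + by move=> r h; apply: Pd; lia.
  + by move=> r h; apply: Pd; lia.
Qed.

Lemma exec_move a b s : a != b ->
  exists2 s', exec (move_cmd a b) s s' &
    forall x, s' x = if x == a then 0 else if x == b then s b + s a else s x.
Proof.
move=> ab.
pose I m (t : regs) := m <= s a /\
  forall x, t x = if x == a then m else if x == b then s b + (s a - m) else s x.
have [|||s' e [_ h]] := @exec_loop a (Inc b) I (s a) s.
- by move=> m t [_ ->]; rewrite eqxx.
- move=> m t [hm ht]; eexists; first exact: ExecInc.
  split; first exact: ltnW.
  move=> x; have := ht x; have := ht b; move: ab; rewrite /update !eqxx.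
  case: (x =P b) => [->|xb]; last by case: (x =P a).
  by rewrite eq_sym => /negbTE -> ->; lia.
- split=> // x; case: eqP => [->//|_]; case: eqP => // ->; lia.
- by exists s' => // x; rewrite h subn0.
Qed.

Lemma exec_double a b s : a != b ->
  exists2 s', exec (Loop a (Seq (Inc b) (Inc b))) s s' &
    forall x, s' x = if x == a then 0 else if x == b then s b + (s a).*2 else s x.
Proof.
move=> ab.
pose I m (t : regs) := m <= s a /\
  forall x, t x = if x == a then m else if x == b then s b + (s a - m).*2 else s x.
have [|||s' e [_ h]] := @exec_loop a (Seq (Inc b) (Inc b)) I (s a) s.
- by move=> m t [_ ->]; rewrite eqxx.
- move=> m t [hm ht]; eexists; first by apply: ExecSeq; exact: ExecInc.
  split; first exact: ltnW.
  move=> x; have := ht x; have := ht b; move: ab; rewrite /update !eqxx.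
  case: (x =P b) => [->|xb]; last by case: (x =P a).
  by rewrite eq_sym => /negbTE -> ->; lia.
- split=> // x; case: eqP => [->//|_]; case: eqP => // ->; lia.
- by exists s' => // x; rewrite h subn0.
Qed.

Lemma exec_copy x d t s : x != d -> x != t -> d != t -> s d = 0 -> s t = 0 ->
  exists2 s', exec (copy_cmd x d t) s s' &
    forall y, s' y = if y == d then s x else s y.
Proof.
move=> xd xt dt sd st.
pose I m (u : regs) := m <= s x /\
  forall y, u y = if y == x then m else if (y == d) || (y == t) then s x - m else s y.
have [|||s1 e1 [_ h1]] := @exec_loop x (Seq (Inc d) (Inc t)) I (s x) s.
- by move=> m u [_ ->]; rewrite eqxx.
- move=> m u [hm hu]; eexists; first by apply: ExecSeq; exact: ExecInc.
  split; first exact: ltnW.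
  move=> y; have := hu y; have := hu d; have := hu t; rewrite /update !eqxx.
  rewrite ![_ == x]eq_sym (negbTE xd) (negbTE xt) ![t == _]eq_sym (negbTE dt) orbT /=.
  move: xd xt dt.
  case: (y =P t) => [->|yt]; first by move=> _ /negbTE-> _; rewrite orbT; lia.
  case: (y =P d) => [->|yd]; first by move=> /negbTE-> _ _ /=; lia.
  by move=> _ _ _ _ _ ->; case: (x == y).
- split=> // y; case: eqP => [->//|_]; case: eqP => [->|_] /=; first lia.
  by case: eqP => // ->; lia.
have [|s2 e2 h2] := @exec_move t x s1; first by rewrite eq_sym.
exists s2; first by apply: ExecSeq e1 e2.
move=> y; rewrite h2 !h1 eqxx ![t == _]eq_sym (negbTE xt) eqxx orbT.
case: (y =P t) => [->|yt]; first by rewrite eq_sym (negbTE dt).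
case: (y =P x) => [->|yx]; first by rewrite (negbTE xd); lia.
by rewrite orbF subn0.
Qed.

Lemma exec_node a b t s : a != b -> a != t -> b != t -> s t = 0 ->
  exists2 s', exec (node_cmd a b t) s s' &
    forall y, s' y = if y == a then node (s a) (s b) else if y == b then 0 else s y.
Proof.
move=> ab at_ bt st.
have [s1 e1 h1] := @exec_double b t s bt.
pose s2 := update s1 t (s1 t).+1.
have h2 y : s2 y = if y == b then 0 else if y == t then (s b).*2.+1 else s y.
  rewrite /s2 /update !h1 eqxx ![t == _]eq_sym (negbTE bt) st.
  case: (y =P t) => [->|//]; by rewrite eq_sym (negbTE bt).
pose I m (u : regs) := m <= s a /\ forall y, u y = if y == a then m else
  if y == b then 0 else if y == t then expn 2 (s a - m) * (s b).*2.+1 else s y.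
have [|||s3 e3 [_ h3]] := @exec_loop a
  (Seq (Loop t (Seq (Inc b) (Inc b))) (move_cmd b t)) I (s a) s2.
- by move=> m u [_ ->]; rewrite eqxx.
- move=> m u [hm hu]; pose u1 := update u a m.
  have [|u2 f2 k2] := @exec_double t b u1; first by rewrite eq_sym.
  have [u3 f3 k3] := @exec_move b t u2 bt.
  exists u3; first exact: ExecSeq f2 f3.
  split=> [|y]; first exact: ltnW.
  rewrite k3 !k2 /u1 /update !hu !eqxx (negbTE bt) ![t == _]eq_sym ![b == a]eq_sym (negbTE bt).
  rewrite (negbTE ab) (negbTE at_).
  case: (y =P b) => [->|yb]; first by rewrite eq_sym (negbTE ab).
  case: (y =P t) => [->|yt].
    rewrite eq_sym (negbTE at_) !add0n.
    have -> : s a - m = (s a - m.+1).+1 by lia.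
    by rewrite expnS -mul2n mulnA.
  by case: (y =P a).
- split=> // y; rewrite h2 subnn expn0 mul1n; case: (y =P a) => // ->.
  by rewrite (negbTE ab) (negbTE at_).
have [|s4 e4 h4] := @exec_move t a s3; first by rewrite eq_sym.
exists s4.
  by apply: ExecSeq (ExecSeq e3 e4); apply: ExecSeq e1 _; apply: ExecInc.
move=> y; rewrite h4 !h3 !eqxx subn0 ![t == _]eq_sym (negbTE at_) (negbTE bt) add0n.
case: (y =P t) => [->|yt]; first by rewrite ![t == _]eq_sym (negbTE at_) (negbTE bt).
by case: (y =P a).
Qed.

Lemma exec_expr x d e s : x < d -> (forall r, d <= r -> s r = 0) ->
  exists2 s', exec (expr_cmd x d e) s s' &
    forall y, s' y = if y == d then eval (s x) e else s y.
Proof.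
elim: e d s => [c|/=|e1 IH1 e2 IH2 /=] d s xd sd.
- suff [s' e h] : exists2 s', exec (expr_cmd x d (EConst c)) s s' &
      forall y, s' y = if y == d then s d + c else s y.
    by exists s' => // y; rewrite h sd.
  elim: c s {sd} => [|c IH] s /=.
    by exists s; [exact: ExecSkip | move=> y; case: eqP => // ->; rewrite addn0].
  have [s' e h] := IH (update s d (s d).+1).
  exists s'; first by apply: ExecSeq e; apply: ExecInc.
  by move=> y; rewrite h /update eqxx addSnnS; case: eqP.
- by apply: exec_copy; rewrite ?sd //; lia.
- have [s1 f1 h1] := IH1 d s xd sd.
  have [||s2 f2 h2] := IH2 d.+1 s1; first lia.
    by move=> r hr; rewrite h1 ifF ?sd //; lia.
  have [||||s3 f3 h3] := @exec_node d d.+1 d.+2 s2; try lia.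
    by rewrite h2 ifF; [rewrite h1 ifF ?sd //; lia | lia].
  exists s3; first by apply: ExecSeq f1 (ExecSeq f2 f3).
  move=> y; rewrite h3 !h2 !h1 eqxx.
  have -> : (d == d.+1) = false by lia.
  have -> : (x == d) = false by lia.
  rewrite eqxx; case: (y =P d) => // yd; case: (y =P d.+1) => // ->.
  by rewrite sd.
Qed.

(** A program halts at every position beyond its end; [minn] sends all such jumps to the first line
    after the embedded copy. *)
Definition shift_instr (off sz : nat) (i : instr) : instr :=
  match i with INC r => INC r | DEC r j => DEC r (off + minn j sz) end.

Lemma embed_correct Rp p pre post k c0 s0 :
  uses_regs Rp p -> c0 <= size p ->
  let q := pre ++ map (shift_instr (size pre) (size p)) p ++ post in
  forall t0, (forall r, r < Rp -> t0 r = s0 r) ->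
  let c := iter k (step p) (c0, s0) in
  exists t, [/\ reaches q (size pre + c0, t0) (size pre + minn c.1 (size p), t),
    forall r, r < Rp -> t r = c.2 r & forall r, Rp <= r -> t r = t0 r].
Proof.
move=> Hp hc q t0 ht0; elim: k => [|k] /=.
  by exists t0; split=> //; rewrite (minn_idPl hc); apply: reaches_refl.
case: (iter k _ _) => pc s /= [t [hr ht htR]].
case: (ltnP pc (size p)) => hpc; last by exists t.
have := all_nthP (INC 0) Hp pc hpc.
have qpc : nth (INC 0) q (size pre + pc) = shift_instr (size pre) (size p) (nth (INC 0) p pc).
  rewrite /q nth_cat ltnNge leq_addr /= addKn nth_cat size_map hpc.
  by rewrite (nth_map (INC 0)).
have qsz : size pre + pc < size q by rewrite /q !size_cat size_map; lia.
rewrite (minn_idPl (ltnW hpc)) in hr.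
case E : (nth (INC 0) p pc) qpc => [r|r j] /= qpc rR.
  exists (update t r (t r).+1); split.
  - apply: reaches_trans hr _; apply: reaches_step; rewrite /step qsz qpc.
    by rewrite (minn_idPl hpc) addnS.
  - by move=> x xR; rewrite /update !ht.
  - by move=> x xR; rewrite /update; case: eqP => [xr|_]; [lia | rewrite htR].
case Es : (s r) => [|m] /=.
  exists t; split=> //.
  apply: reaches_trans hr _; apply: reaches_step; rewrite /step qsz qpc.
  by rewrite ht // Es.
exists (update t r m); split.
- apply: reaches_trans hr _; apply: reaches_step; rewrite /step qsz qpc.
  by rewrite ht // Es (minn_idPl hpc) addnS.
- by move=> x xR; rewrite /update !ht.
- by move=> x xR; rewrite /update; case: eqP => [xr|_]; [lia | rewrite htR].
Qed.

(** A halted configuration repeats forever, so the sum over the finitely many earlier steps bounds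
    everything. *)
Lemma halted_bounded R q n s pc :
  reaches q (init_config n) (pc, s) -> size q <= pc -> bounded_run R q n.
Proof.
move=> [k hk] hpc; exists (\sum_(i < k.+1) run_sum R q n i) => j.
have stay i : iter (i + k) (step q) (init_config n) = (pc, s).
  by elim: i => //= i ->; rewrite /step ltnNge hpc.
have le i : i < k.+1 -> run_sum R q n i <= \sum_(i < k.+1) run_sum R q n i.
  by move=> hi; rewrite (bigD1 (Ordinal hi)) //= leq_addr.
case: (ltnP j k.+1) => hj; first exact: le.
apply: leq_trans (le k _) => //.
by rewrite /run_sum hk -(subnK (ltnW hj)) stay.
Qed.

(* The result of [p] on the value of [e] is turned into halting, or into an endless increment
   of register 0. *)
Lemma diagonal_program p D : exists2 R, 0 < R & forall e, edepth e <= D ->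
  exists2 q, uses_regs R q & forall n,
    (halts_with p (eval n e) 0 -> bounded_run R q n) /\
    (halts_with p (eval n e) 1 -> unbounded_run R q n).
Proof.
pose Rp := (\max_(i <- p) instr_reg i).+1.
have pR : uses_regs Rp p.
  rewrite {}/Rp; elim: p => //= i p IH; rewrite big_cons ltnS leq_maxl /=.
  by apply: sub_all IH => j; rewrite !ltnS leq_max => ->; rewrite orbT.
(* Zero register, saved input and scratch space all lie above the registers of [p], so the embedded
   decider starts on clean registers and cannot disturb [z]. *)
pose z := Rp; pose x := Rp.+1; pose d := Rp.+2; pose R := d + D + 3.
exists R => [|e eD]; first by rewrite /R addn3.
pose c := Seq (move_cmd 0 x) (Seq (expr_cmd x d e) (move_cmd d 0)).
pose o := csize c + size p.
(* With answer 0 the first line jumps behind the end of the code; with answer 1 it falls through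
   into the endless loop formed by the other two. *)
pose tl := [:: DEC 0 (o + 3); INC 0; DEC z o.+1].
pose code := map (shift_instr (csize c) (size p)) p.
pose q := compile z 0 c ++ code ++ tl.
have zR : z < R by rewrite /z /R /d; lia.
exists q.
  rewrite /uses_regs (all_cat _ (compile z 0 c)) (all_cat _ code); apply/and3P; split.
  - apply: (@uses_compile R z 0 c) => //=; rewrite expr_cmd_regs ?andbT /=; rewrite /R /d /x; try lia.
  - rewrite all_map; apply: sub_all pR => i /=.
    by case: i => [r|r j] /=; rewrite /R /d; lia.
  - by rewrite /= zR; rewrite /R /d; lia.
move=> n; pose s0 := (init_config n).2.
have [s1 e1 h1] := @exec_move 0 x s0 isT.
have [||s2 e2 h2] := @exec_expr x d e s1; first by rewrite /x /d; lia.
  by move=> r hr; rewrite h1 /s0 /= !ifF //; move: hr; rewrite /d /x; lia.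
have [|s3 e3 h3] := @exec_move d 0 s2; first by [].
have s1x : s1 x = n by rewrite h1 eqxx /s0.
have h30 : s3 0 = eval n e.
  by rewrite h3 !h2 eqxx s1x /= eqxx h1.
have h3r r : 0 < r -> r != x -> s3 r = 0.
  move=> r0 rx; rewrite h3; case: eqP => // rd; case: eqP => [|_]; first lia.
  rewrite h2; case: eqP => // _; rewrite h1 (negbTE rx) /s0 /=.
  by case: eqP => //; lia.
have run1 : reaches q (init_config n) (csize c, s3).
  apply: (@compile_correct z c s0 s3 [::]) => //.
  - by apply: ExecSeq e1 (ExecSeq e2 e3).
  - rewrite /= expr_cmd_regs; rewrite ?/z ?/x ?/d ?andbT //; try lia.
have sq : size q = o + 3.
  by rewrite /q (size_cat (compile z 0 c)) (size_cat code) size_compile size_map /o addnA.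
have run2 v : halts_with p (eval n e) v -> exists t,
    [/\ reaches q (init_config n) (o, t), t 0 = v & t z = 0].
  move=> [k /= [hk hv]].
  have [||t [hr ht htR]] := @embed_correct Rp p (compile z 0 c) tl k 0
    (init_config (eval n e)).2 pR _ s3; first by [].
    move=> r hr /=; case: eqP => [->//|r0].
    by apply: h3r; [|rewrite /x]; lia.
  exists t; rewrite size_compile addn0 in hr.
  split; last 1 first.
  - by rewrite htR // h3r // /z /x; lia.
  - apply: reaches_trans run1 _; move: hr.
    by rewrite (minn_idPr hk).
  - by rewrite ht.
have nq i : i < 3 -> nth (INC 0) q (o + i) = nth (INC 0) tl i.
  move=> hi; have -> : o = size (compile z 0 c ++ code).
    by rewrite size_cat size_compile size_map.
  by rewrite /q catA nth_cat ltnNge leq_addr /= addKn.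
split=> [/run2[t [hr ht tz]]|/run2[t [hr ht tz]] B].
  apply: (@halted_bounded R q n t (o + 3)); last by rewrite sq.
  apply: reaches_trans hr _; apply: reaches_step.
  have := nq 0 isT; rewrite addn0 /step sq => -> /=.
  by rewrite ht ifT //; lia.
have loop m : exists u, [/\ reaches q (init_config n) (o.+1, u), u 0 = m & u z = 0].
  elim: m => [|m [u [hu u0 uz]]].
    exists (update t 0 0); split=> //.
    apply: reaches_trans hr _; apply: reaches_step.
    have := nq 0 isT; rewrite addn0 /step sq => -> /=.
    by rewrite ht ifT //; lia.
  exists (update u 0 m.+1); split=> //.
  apply: reaches_trans hu _.
  apply: (@reaches_trans _ _ (o.+2, update u 0 m.+1)); apply: reaches_step.
    by have := nq 1 isT; rewrite addn1 /step sq => -> /=; rewrite u0 ifT //; lia.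
  have := nq 2 isT; rewrite addn2 /step sq => -> /=.
  have -> : update u 0 m.+1 z = 0 by rewrite /update /z /=.
  by rewrite ifT //; lia.
have [u [[k hk] u0 _]] := loop B.+1.
exists k; rewrite /run_sum hk.
have R0 : 0 < R by rewrite /R addn3.
by rewrite (bigD1 (Ordinal R0)) //= u0; lia.
Qed.

(** * The game *)

(** A growing round frees all tokens and adds one; it then loads register 0, one token per round.
    [Load0], [LoadLast] and [Exec pc] still wait for the one effective change of the round, [Load1]
    and [Done pc] come after it; [LoadLast] is the loading round in which the stopwatch is claimed
    to show n. *)
Inductive phase := Start | Grow0 | Grow1 | Grow2 | Load0 | Load1 | LoadLast
  | Exec of nat | Done of nat.

Definition phase_code (d : phase) : nat * nat :=
  match d with
  | Start => (0, 0) | Grow0 => (1, 0) | Grow1 => (2, 0) | Grow2 => (3, 0)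
  | Load0 => (4, 0) | Load1 => (5, 0) | LoadLast => (6, 0)
  | Exec i => (7, i) | Done i => (8, i)
  end.

Definition phase_decode (c : nat * nat) : phase :=
  match c with
  | (0, _) => Start | (1, _) => Grow0 | (2, _) => Grow1 | (3, _) => Grow2
  | (4, _) => Load0 | (5, _) => Load1 | (6, _) => LoadLast
  | (7, i) => Exec i | (_, i) => Done i
  end.

Lemma phase_codeK : cancel phase_code phase_decode. Proof. by case. Qed.

HB.instance Definition _ := Countable.copy phase (can_type phase_codeK).

(* Token types: 0 is blank, 1 marks the start of a round, 2 is a free token and [r + 3] a token
   of register [r]. *)
Notation token nr := 'I_nr.+3.

(* [inl (x, y)] claims that the event exactly one time unit ago left a token [x] and replaces it
   by [y]; [inr true] starts a stopwatch and [inr false] claims that it shows [n]. *)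
Definition letter (nr : nat) := (token nr * token nr + bool)%type.

Section Letters.
Variable nr : nat.
Implicit Type l : letter nr.

Definition old l : token nr := if l is inl (x, _) then x else ord0.
Definition new l : token nr := if l is inl (_, y) then y else ord0.
Definition watch : letter nr := inr true.
Definition expire : letter nr := inr false.
Definition blank : letter nr := inl (ord0, ord0).
Definition is_hash l : bool := new l == 1 :> nat.

End Letters.

Section Phases.
Variables (nr : nat) (q : program).

Definition instr_at (pc : nat) : option instr :=
  if pc < size q then Some (nth (INC 0) q pc) else None.

(** Except in [Start], [None] marks the type that the phase waits for: such a token can only be
    changed or lost. A round that ends without the change therefore leaves no token of this type. *)
Definition copies (d : phase) (x : nat) : option nat :=
  match d with
  | Start => None
  | Grow0 | Grow1 | Grow2 => Some 2
  | Load0 | LoadLast => if x == 2 then None else Some x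
  | Load1 | Done _ => Some x
  | Exec pc =>
      match instr_at pc with
      | Some (INC _) => if x == 2 then None else Some x
      | Some (DEC r _) => if x == r.+3 then None else Some x
      | None => Some x
      end
  end.

Definition change (d : phase) : option (nat * nat * phase) :=
  match d with
  | Start => Some (0, 1, Grow0)
  | Grow1 => Some (0, 2, Grow2)
  | Load0 => Some (2, 3, Load1)
  | LoadLast => Some (2, 3, Done 0)
  | Exec pc =>
      match instr_at pc with
      | Some (INC r) => Some (2, r.+3, Done pc.+1)
      | Some (DEC r _) => Some (r.+3, 2, Done pc.+1)
      | None => None
      end
  | _ => None
  end.

(** Ending a round in a waiting phase means that the awaited type has run out. For a decrement this
    is the zero test; for an increment or the last load it is the lack of free tokens, which alone
    leads back to [Grow0]. *)
Definition next_round (d : phase) : option phase :=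
  match d with
  | Grow2 | Load0 | Load1 => Some Load0
  | LoadLast => Some Grow0
  | Exec pc =>
      match instr_at pc with
      | Some (INC _) => Some Grow0
      | Some (DEC _ j) => Some (Exec j)
      | None => None
      end
  | Done pc => Some (Exec pc)
  | _ => None
  end.

Definition advance (d : phase) (l : letter nr) : option phase :=
  match l with
  | inr true => if d is Grow0 then Some Grow1 else None
  | inr false => if d is Load0 then Some LoadLast else None
  | inl (x, y) =>
      let copy := if (1 < x) && (copies d x == Some (y : nat)) then Some d else None in
      if (x == 0 :> nat) && (y == 0 :> nat) then Some d
      else if (x == 1 :> nat) && (y == 1 :> nat) then next_round d
      else match change d with
           | Some (x', y', d') =>
               if (x == x' :> nat) && (y == y' :> nat) then Some d' else copy
           | None => copy
           end
  end.

Variant advance_spec (d : phase) (l : letter nr) (d' : phase) : Prop :=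
| AdvWatch of l = watch nr & d = Grow0 & d' = Grow1
| AdvExpire of l = expire nr & d = Load0 & d' = LoadLast
| AdvBlank of l = blank nr & d' = d
| AdvHash of old l = 1 :> nat & new l = 1 :> nat & next_round d = Some d'
| AdvChange of change d = Some (old l : nat, new l : nat, d')
| AdvCopy of 1 < old l & copies d (old l) = Some (new l : nat) & d' = d.

Lemma advanceP d l d' : advance d l = Some d' -> advance_spec d l d'.
Proof.
case: l => [[x y]|[]] /=; last 1 first.
- by case: d => // -[<-]; apply: AdvExpire.
- case: andP => [[/eqP x0 /eqP y0] [<-]|_].
    by apply: AdvBlank => //; congr (inl (_, _)); apply: val_inj.
  case: andP => [[/eqP x0 /eqP y0] h|_]; first exact: AdvHash.
  have cp : (if (1 < x) && (copies d x == Some (y : nat)) then Some d else None) = Some d' ->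
      advance_spec d (inl (x, y)) d'.
    by case: andP => // -[x1 /eqP hc] [<-]; apply: AdvCopy.
  case E: (change d) => [[[x' y'] d'']|] //.
  case: andP => [[/eqP hx /eqP hy] [<-]|_] //.
  by apply: AdvChange; rewrite E -hx -hy.
- by case: d => // -[<-]; apply: AdvWatch.
Qed.

End Phases.

(* A location of the automaton: [None] is the accepting sink; otherwise the phase of the round
   comes with [None] (nothing guessed), [Some None] (the clock runs since the stopwatch was
   started) or [Some (Some x)] (the clock runs since a guessed event that left a token [x]). *)
Definition location (nr : nat) := option (phase * option (option (token nr))).

(* Opaque, so that the huge numbers produced by [pickle] are never computed. *)
Lemma location_coding nr : {f : location nr -> nat | injective f}.
Proof. by exists pickle; apply: pcan_inj pickleK. Qed.

Definition location_code nr : location nr -> nat := sval (location_coding nr).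

Lemma location_code_inj nr : injective (@location_code nr).
Proof. exact: (svalP (location_coding nr)). Qed.

(* [None] is no constraint, [Some None] is 0 < x < 1 and [Some (Some n)] is x = n. *)
Definition test := option (option nat).

(* source, letter of Player I, answer of Player II ([true] = objection), test, reset, target *)
Definition edge (nr : nat) :=
  (location nr * letter nr * bool * test * bool * location nr)%type.

Section Edges.
Variable nr : nat.
Implicit Type e : edge nr.

Definition e_src e := let: (s, _, _, _, _, _) := e in s.
Definition e_letter e := let: (_, l, _, _, _, _) := e in l.
Definition e_answer e := let: (_, _, b, _, _, _) := e in b.
Definition e_test e := let: (_, _, _, g, _, _) := e in g.
Definition e_reset e := let: (_, _, _, _, r, _) := e in r.
Definition e_tgt e := let: (_, _, _, _, _, t) := e in t.

Definition letter_code (l : letter nr) : nat := enum_rank l.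

Definition op_lt : cmp := @Ordinal 5 0 isT.
Definition op_eq : cmp := @Ordinal 5 2 isT.
Definition op_gt : cmp := @Ordinal 5 4 isT.

Definition guard_of (g : test) : guard :=
  match g with
  | None => [:: [::]]
  | Some None => [:: [:: (0, None, op_gt, Posz 0); (0, None, op_lt, Posz 1)]]
  | Some (Some n) => [:: [:: (0, None, op_eq, Posz n)]]
  end.

Definition test_sat (g : test) (x : R) : Prop :=
  match g with
  | None => True
  | Some None => Rlt 0 x /\ Rlt x 1
  | Some (Some n) => x = INR n
  end.

Definition transition_of e : transition :=
  (location_code (e_src e), Some (letter_code (e_letter e), nat_of_bool (e_answer e)),
   guard_of (e_test e), if e_reset e then [:: 0] else [::], location_code (e_tgt e)).

Lemma guard_ofP v g : guard_sat v (guard_of g) <-> test_sat g (v 0).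
Proof.
rewrite /guard_sat; case: g => [[n|]|] /=; split.
- case=> c; rewrite inE => /eqP-> /(_ _ (mem_head _ _)) /=.
  by rewrite /cmp_sat /= Rminus_0_r.
- move=> h; exists [:: (0, None, op_eq, Posz n)]; first exact: mem_head.
  by move=> a; rewrite inE => /eqP->; rewrite /= /cmp_sat /= Rminus_0_r.
- case=> c; rewrite inE => /eqP-> h.
  have := h (0, None, op_gt, Posz 0); have := h (0, None, op_lt, Posz 1).
  rewrite !inE !eqxx ?orbT /= /cmp_sat /= Rminus_0_r => /(_ isT) h1 /(_ isT) h2.
  by split; lra.
- move=> [h1 h2]; eexists; first exact: mem_head.
  by move=> a; rewrite !inE => /orP[]/eqP->; rewrite /= /cmp_sat /= Rminus_0_r; lra.
- by [].
- by move=> _; exists [::]; rewrite ?mem_head.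
Qed.

End Edges.

Section Instance.
Variables (nr : nat) (q : program).

(** Positions up to and including [size q], the halted one. A jump further out leaves this list, and
    no rule starts from there. *)
Definition phases : seq phase :=
  [:: Start; Grow0; Grow1; Grow2; Load0; Load1; LoadLast] ++
  map Exec (iota 0 (size q).+1) ++ map Done (iota 0 (size q).+1).

Definition sink : location nr := None.

(** The test 0 < x < 1 on the way makes the guessed event the last one at its time and the checked
    letter the first one a full unit later. In the final rule the answer [old l == x] is exactly the
    wrong one: an objection to a true claim or silence about a false one. *)
Definition out_edges (d : phase) (l : letter nr) (ph : option (option (token nr))) :
    seq (edge nr) :=
  if advance q d l is Some d' then
    match ph with
    | None =>
        [:: (Some (d, ph), l, false, None, false, Some (d', ph));
            (Some (d, ph), l, false, None, true, Some (d', Some (Some (new l))))] ++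
        (if l == watch nr
         then [:: (Some (d, ph), l, false, None, true, Some (d', Some None))] else [::]) ++
        (if (old l == ord0) && (l != expire nr)
         then [:: (Some (d, ph), l, true, None, false, sink)] else [::])
    | Some None =>
        if l == watch nr then [::]
        else [:: (Some (d, ph), l, false, None, false, Some (d', ph))]
    | Some (Some x) =>
        (Some (d, ph), l, false, Some None, false, Some (d', ph)) ::
        (if old l == ord0 then [::]
         else [:: (Some (d, ph), l, old l == x, Some (Some 1), false, sink)])
    end
  else [::].

Definition sink_edges : seq (edge nr) :=
  flatten [seq [seq (sink, l, b, None, false, sink) | b <- [:: false; true]]
          | l <- enum {: letter nr}].

Definition edges : seq (edge nr) :=
  sink_edges ++
  flatten [seq flatten [seq flatten [seq out_edges d l ph | ph <- enum {: option (option (token nr))}]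
                       | l <- enum {: letter nr}] | d <- phases].

(** Kept apart from [edges] so that [rules] does not depend on [n]. Only a wrong objection to
    [expire] is punished, not silence: Player II can check the claim with a single clock. *)
Definition expire_edge (n : nat) : edge nr :=
  (Some (Load0, Some None), expire nr, true, Some (Some n), false, sink).

Definition all_edges (n : nat) : seq (edge nr) := expire_edge n :: edges.

Definition rules : seq transition := map (@transition_of nr) edges.

Definition reduction (n : nat) : instance :=
  (#|{: letter nr}|, 2,
   ([:: location_code (Some (Start, None) : location nr)], [:: location_code sink],
    transition_of (expire_edge n) :: rules)).

Lemma out_edges_mem d l ph e : d \in phases -> e \in out_edges d l ph -> e \in edges.
Proof.
move=> hd he; rewrite mem_cat; apply/orP; right.
apply/flatten_mapP; exists d => //; apply/flatten_mapP; exists l; first by rewrite mem_enum.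
by apply/flatten_mapP; exists ph; rewrite // mem_enum.
Qed.

Lemma sink_edge_mem l b : (sink, l, b, None, false, sink) \in edges.
Proof.
rewrite mem_cat; apply/orP; left; apply/flatten_mapP; exists l; first by rewrite mem_enum.
by case: b; rewrite !inE eqxx ?orbT.
Qed.

Variant edge_spec (n : nat) : edge nr -> Prop :=
| EdgeSink l b : edge_spec n (sink, l, b, None, false, sink)
| EdgeExpire : edge_spec n (expire_edge n)
| EdgeOut d l ph e of d \in phases & e \in out_edges d l ph : edge_spec n e.

Lemma edgeP n e : e \in all_edges n -> edge_spec n e.
Proof.
rewrite inE mem_cat => /or3P[/eqP->|/flatten_mapP[l _ /mapP[b _ ->]]|]; first exact: EdgeExpire.
  exact: EdgeSink.
case/flatten_mapP=> d hd /flatten_mapP[l _ /flatten_mapP[ph _ he]].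
exact: EdgeOut hd he.
Qed.

Lemma reduction_one_clock n : one_clock_no_eps (reduction n).
Proof.
move=> t; rewrite -[_ :: _]/(map (@transition_of nr) (all_edges n)) => /mapP[e _ ->].
split=> //=; first by move=> i; case: ifP => _; rewrite ?inE // => /eqP.
move=> c a; case: (e_test e) => [[k|]|] /=; rewrite inE => /eqP->; rewrite ?inE //.
- by move/eqP->; split=> //; left.
- by case/orP=> /eqP->; split=> //; left.
Qed.

(** * Runs of the automaton *)

Definition code_word (l : nat -> letter nr) (b : nat -> bool) (T : nat -> R) : tword :=
  fun i => ((letter_code (l i), nat_of_bool (b i)), T i).

Lemma idx_id (idx : nat -> nat) :
  (forall i, idx i < idx i.+1) -> (forall m, exists i, idx i = m) -> forall i, idx i = i.
Proof.
move=> inc sur.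
have mono i j : i < j -> idx i < idx j.
  elim: j => // j IH; rewrite ltnS leq_eqVlt => /orP[/eqP->//|/IH h].
  exact: ltn_trans h (inc j).
elim/ltn_ind=> i IH; have [j hj] := sur i.
case: (ltngtP i j) => [ij|ji|ij]; last by rewrite {1}ij hj.
  have := mono _ _ ij; rewrite hj => hi.
  by have := mono _ _ hi; rewrite (IH _ hi) ltnn.
by have := IH _ ji; rewrite hj => e; rewrite e ltnn in ji.
Qed.

Lemma play_word k m (C : controller #|{: letter nr}| 2 k m) a t :
  (fun i => ((val (a i), val (ctrl_answer C a t i)), t i)) =1
  code_word (fun i => enum_val (a i)) (fun i => ctrl_answer C a t i == 1 :> nat) t.
Proof.
move=> i; rewrite /code_word /letter_code enum_valK; congr (_, _, _).
by case: ctrl_answer => -[|[|]].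
Qed.

Lemma accepts_edges n w l b T : w =1 code_word l b T -> accepts (reduction n).2 w ->
  exists (e : nat -> edge nr) (v : nat -> R),
    [/\ e_src (e 0) = Some (Start, None), v 0 = R0, exists i, e_tgt (e i) = sink &
    forall i, let x := Rplus (v i) (Rminus (T i) (prev_time T i)) in
      [/\ e i \in all_edges n, e_src (e i.+1) = e_tgt (e i),
          e_letter (e i) = l i /\ e_answer (e i) = b i, test_sat (e_test (e i)) x &
          v i.+1 = if e_reset (e i) then R0 else x]].
Proof.
move=> hw [loc [tr [T' [v [[h0 v0 _ hrun] hb [idx [inc hidx sur]]]]]]].
have he i : exists2 e, e \in all_edges n & tr i = transition_of e.
  by have [_ + _ _ _] := hrun i; rewrite -[_ :: _]/(map (@transition_of nr) (all_edges n)) => /mapP.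
(* All rules carry a letter, so erasing deletes nothing. *)
have idx_i i : idx i = i.
  apply: idx_id => // m; apply: sur.
  by have [e _ ->] := he m.
have hp i : exists e, (e \in all_edges n) && (tr i == transition_of e).
  by have [e eA ->] := he i; exists e; rewrite eA eqxx.
pose e i := xchoose (hp i).
have [eA etr] : (forall i, e i \in all_edges n) /\ forall i, tr i = transition_of (e i).
  by split=> i; have /andP[? /eqP] := xchooseP (hp i).
have TT i : T' i = T i by have [_] := hidx i; rewrite idx_i hw.
have pT i : prev_time T' i = prev_time T i by case: i => //= i.
have src i : location_code (e_src (e i)) = loc i.
  by have [_ _ [<- _] _ _] := hrun i; rewrite etr.
have tgt i : location_code (e_tgt (e i)) = loc i.+1.
  by have [_ _ [_ <-] _ _] := hrun i; rewrite etr.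
exists e, (fun i => v i 0); split.
- by move: h0; rewrite -src inE => /eqP /location_code_inj.
- by rewrite v0.
- have [[|i] // i0] := hb 1; rewrite inE -tgt => /eqP /location_code_inj h.
  by exists i.
- move=> i; have [_ _ _ hg hv] := hrun i; split=> //.
  + by apply: location_code_inj; rewrite src tgt.
  + have [+ _] := hidx i; rewrite idx_i etr hw /= => -[/val_inj/enum_rank_inj -> hb'].
    by split=> //; move: hb'; case: e_answer; case: (b i).
  + by move: hg; rewrite etr => /guard_ofP; rewrite /delay TT pT.
  + by rewrite hv etr /= /reset /delay TT pT; case: e_reset.
Qed.

(** The sink absorbs every letter, so acceptance is decided by a finite path, and such paths can be
    built step by step. *)
Inductive path_to (n : nat) (l : nat -> letter nr) (b : nat -> bool) (T : nat -> R) :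
    nat -> location nr -> R -> Prop :=
| PathNil : path_to n l b T 0 (Some (Start, None)) R0
| PathStep i s x e : path_to n l b T i s x -> e \in all_edges n -> e_src e = s ->
    e_letter e = l i -> e_answer e = b i ->
    test_sat (e_test e) (Rplus x (Rminus (T i) (prev_time T i))) ->
    path_to n l b T i.+1 (e_tgt e)
      (if e_reset e then R0 else Rplus x (Rminus (T i) (prev_time T i))).

Fixpoint clock_of (e : nat -> edge nr) (T : nat -> R) (i : nat) : nat -> R :=
  if i is i'.+1 then
    reset (tr_reset (transition_of (e i')))
      (delay (clock_of e T i') (Rminus (T i') (prev_time T i')))
  else fun _ => R0.

Lemma clock_of_eq e e' T i : (forall j, j < i -> e j = e' j) -> clock_of e T i = clock_of e' T i.
Proof.
elim: i => //= i IH h; rewrite h // IH // => j hj.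
by apply: h; apply: ltnW.
Qed.

Lemma accepts_path n w l b T i x : w =1 code_word l b T ->
  Rle R0 (T 0) -> (forall i, Rle (T i) (T i.+1)) ->
  path_to n l b T i sink x -> accepts (reduction n).2 w.
Proof.
move=> hw T0 Tinc hpath.
have [e [he e0 hs]] : exists e : nat -> edge nr,
  [/\ forall j, j < i -> [/\ e j \in all_edges n,
        e_letter (e j) = l j /\ e_answer (e j) = b j,
        test_sat (e_test (e j)) (clock_of e T j 0 + (T j - prev_time T j))%R &
        j.+1 < i -> e_src (e j.+1) = e_tgt (e j)],
      0 < i -> e_src (e 0) = Some (Start, None) &
      (if i is j.+1 then e_tgt (e j) else Some (Start, None)) = sink /\
      clock_of e T i 0 = x].
  elim: hpath => [|{}i s {}x e _ [f [hf f0 [ft fx]]] eA es el eb et].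
    exists (fun _ => expire_edge n); split=> //.
  pose f' j := if j < i then f j else e.
  have f'i : f' i = e by rewrite /f' ltnn.
  have f'l j : j < i -> f' j = f j by rewrite /f' => ->.
  have cl j : j <= i -> clock_of f' T j = clock_of f T j.
    by move=> hj; apply: clock_of_eq => k hk; apply: f'l; apply: leq_trans hj.
  exists f'; split.
  - move=> j; rewrite ltnS leq_eqVlt => /orP[/eqP->|hj].
      by rewrite f'i cl // fx ltnn.
    rewrite cl ?(f'l j) //; last exact: ltnW.
    have [h1 h2 h3 h4] := hf j hj; split=> // _.
    case: (ltnP j.+1 i) => hj1; first by rewrite f'l //; apply: h4.
    have ij : i = j.+1 by apply/eqP; rewrite eqn_leq hj hj1.
    by move: f'i ft; rewrite ij => -> ->.
  - move=> _; case: (posnP i) => [i0|i0]; last by rewrite f'l //; apply: f0.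
    by move: f'i ft; rewrite i0 => -> ->.
  - by rewrite f'i /= f'i cl // -fx /reset /delay; case: (e_reset e).
case: hs => hs _.
have i0 : 0 < i by case: (i) hs.
(* Behind the finite path the run loops in the sink forever. *)
pose f j := if j < i then e j else (sink, l j, b j, None, false, sink) : edge nr.
have fl j : j < i -> f j = e j by rewrite /f => ->.
have fA j : f j \in all_edges n.
  rewrite /f; case: ifP => hj; first by have [] := he j hj.
  by rewrite inE sink_edge_mem orbT.
have fnext j : e_src (f j.+1) = e_tgt (f j).
  rewrite /f; case: (ltnP j.+1 i) => hj.
    by rewrite (ltnW hj); have [_ _ _ ->] := he j (ltnW hj).
  case: (ltnP j i) => // hj'; have ij : i = j.+1 by apply/eqP; rewrite eqn_leq hj hj'.
  by move: hs; rewrite ij.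
exists (fun j => location_code (e_src (f j))), (fun j => transition_of (f j)), T, (clock_of f T).
split.
- split=> //; first by rewrite (fl 0 i0) e0 // inE.
  move=> j /=; split=> //.
  + by rewrite -[_ :: _]/(map (@transition_of nr) (all_edges n)) map_f.
  + by rewrite fnext.
  + apply/guard_ofP; rewrite /delay; case: (ltnP j i) => hj; last by rewrite /f ltnNge hj.
    have [_ _ + _] := he j hj; rewrite (fl j) // (@clock_of_eq f e T j) // => k hk.
    by apply: fl; apply: ltn_trans hj.
- move=> N; exists (N + i); first exact: leq_addr.
  by rewrite /f ltnNge leq_addl inE.
- exists (fun j => j); split=> // [j|m _]; last by exists m.
  rewrite hw; split=> //=; rewrite /f; case: (ltnP j i) => hj //=.
  by have [_ [-> ->] _ _] := he j hj.
Qed.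

End Instance.

(** * A controller for bounded runs *)

Definition rltb (x y : R) : bool := if Rlt_dec x y then true else false.
Definition reqb (x y : R) : bool := if Req_EM_T x y then true else false.

Lemma rltbP x y : reflect (Rlt x y) (rltb x y).
Proof. by rewrite /rltb; case: Rlt_dec => h; constructor. Qed.

Lemma reqbP x y : reflect (x = y) (reqb x y).
Proof. by rewrite /reqb; case: Req_EM_T => h; constructor. Qed.

Section Controller.
Variables (nr : nat) (q : program) (n K : nat).

(* A slot holds a token together with the information whether it was put there in the current
   round; its clock measures the time since then. *)
Definition slots := {ffun 'I_K -> option (token nr * bool)}.

Implicit Types (sl : slots) (l : letter nr) (live one : 'I_K -> bool).

(** A round mark turns the tokens of the current round into those of the previous one, and discards
    what was still left from before. *)
Definition age (h : bool) (o : option (token nr * bool)) :=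
  if h then (if o is Some (x, true) then Some (x, false) else None) else o.

(** [live] will mean that the clock lies strictly between 0 and 1, as in the test of the automaton:
    at 0 the token is superseded by a simultaneous event, from 1 on its re-enactment has been
    missed. *)
Definition keep sl l live (s : 'I_K) := if live s then age (is_hash l) (sl s) else None.

Definition token_at sl (s : 'I_K) : nat := if sl s is Some (x, _) then (x : nat) else 0.

(** The slot that the letter writes to: an empty one for a creation, the slot of the claimed token
    with clock exactly 1 for a claim. In the latter case [None] says that the claim is false. *)
Definition target sl l live one : option 'I_K :=
  if old l == ord0 then
    if new l == ord0 then None else [pick s | keep sl l live s == None]
  else [pick s | one s && (token_at sl s == old l)].

Definition refill sl l live one : slots :=
  [ffun s => if target sl l live one == Some s then Some (new l, true) else keep sl l live s].

Definition objects sl l live one (zn : bool) : bool :=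
  if l == expire nr then ~~ zn else (old l != ord0) && (target sl l live one == None).

Definition full sl := forall s, sl s <> None.

Definition count_at sl (y : nat) : nat := #|[set s | token_at sl s == y]|.

(* The simulation of the counter machine is faithful as long as no slot is empty. *)
Definition faithful (d : phase) sl (mu : 'I_K -> R) (z : R) : Prop :=
  match d with
  | Start | Grow0 | Grow1 => False
  | Grow2 => True
  | Load0 => exists i s, [/\ 0 < i, token_at sl s = 1,
        (INR i - 1 < z - mu s < INR i)%R &
        i <= n -> count_at sl 3 = i.-1 /\ forall r, 0 < r < nr -> count_at sl r.+3 = 0]
  | Load1 => exists i s, [/\ 0 < i, token_at sl s = 1,
        (INR i - 1 < z - mu s < INR i)%R &
        i <= n -> count_at sl 3 = i /\ forall r, 0 < r < nr -> count_at sl r.+3 = 0]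
  | LoadLast => count_at sl 3 = n.-1 /\ forall r, 0 < r < nr -> count_at sl r.+3 = 0
  | Exec pc | Done pc => exists k rg, iter k (step q) (init_config n) = (pc, rg) /\
        forall r, r < nr -> count_at sl r.+3 = rg r
  end.

(** The aim is [inv_full]: it excludes full slots in the phases that create tokens, so a new token
    always finds an empty slot. The other fields serve its preservation and identify the tokens of
    the current round. *)
Record invariant (d : phase) sl (mu : 'I_K -> R) (z : R) : Prop := Invariant {
  inv_nonblank : forall s x b, sl s = Some (x, b) -> x != ord0;
  inv_hash_uniq : forall s s', token_at sl s = 1 -> token_at sl s' = 1 -> s = s';
  inv_hash_current : forall s x b, sl s = Some (x, b) -> x = 1 :> nat -> b;
  inv_start : d = Start -> forall s, sl s = None;
  inv_older : forall s s' x, sl s = Some (x, false) -> token_at sl s' = 1 -> Rlt (mu s') (mu s);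
  inv_copied : forall s x, sl s = Some (x, true) ->
    x = 1 :> nat \/ exists2 y, 1 < y & copies q d y = Some (x : nat);
  inv_watch : d = Grow1 \/ d = Grow2 -> forall s, token_at sl s = 1 ->
    (-1 < z - mu s < 0)%R;
  inv_full : full sl -> faithful d sl mu z
}.

Lemma refill_target sl l live one s :
  target sl l live one = Some s -> refill sl l live one s = Some (new l, true).
Proof. by move=> h; rewrite ffunE h eqxx. Qed.

Lemma refill_other sl l live one s :
  target sl l live one <> Some s -> refill sl l live one s = keep sl l live s.
Proof. by move=> h; rewrite ffunE; case: eqP. Qed.

Lemma target_old sl l live one s : old l != ord0 -> target sl l live one = Some s ->
  one s /\ token_at sl s = old l.
Proof.
rewrite /target => /negbTE->; case: pickP => // s' /andP[h1 /eqP h2] [<-].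
by [].
Qed.

Lemma keep_some sl l live s x b : keep sl l live s = Some (x, b) ->
  live s /\ exists b', sl s = Some (x, b') /\ b = b' && ~~ is_hash l /\ (is_hash l -> b').
Proof.
rewrite /keep; case: (live s) => //; case: (sl s) => [[y c]|]; rewrite /age; case: is_hash => //.
  by case: c => // -[-> <-]; split=> //; exists true.
by move=> [-> ->]; split=> //; exists b; rewrite andbT.
Qed.

(** Only a creation can occupy an additional slot. So after any other accepted letter full slots
    were full before, and no token was lost. *)
Lemma full_refill sl l live one zn :
  full (refill sl l live one) -> (old l != ord0) || (new l == ord0) ->
  objects sl l live one zn = false ->
  let sl' := refill sl l live one in
  [/\ full sl,
      forall s, target sl l live one <> Some s -> live s /\ token_at sl' s = token_at sl s,
      forall s, target sl l live one = Some s -> [/\ one s, token_at sl s = old l & token_at sl' s = new l],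
      is_hash l -> old l = new l -> forall s, exists x, sl s = Some (x, true) \/ sl s = Some (x, false) /\ x = 1 :> nat &
      old l != ord0 -> exists s, target sl l live one = Some s].
Proof.
move=> hf hl ho sl'.
have T1 s : target sl l live one = Some s -> [/\ one s, token_at sl s = old l & token_at sl' s = new l].
  move=> hs; have l0 : old l != ord0.
    by case/orP: hl => // h; move: hs; rewrite /target h; case: ifP.
  by have [h1 h2] := target_old l0 hs; rewrite {2}/token_at /sl' refill_target.
have T2 s : target sl l live one <> Some s -> exists x b b', [/\ live s, sl' s = Some (x, b), sl s = Some (x, b') & is_hash l -> b'].
  move=> hs; have := hf s; rewrite -/sl' /sl' refill_other //.
  case E : keep => [[x b]|] // _; have [lv [b' [e1 [_ e3]]]] := keep_some E.
  by exists x, b, b'.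
split=> //.
- move=> s; case E : (target sl l live one == Some s).
    move/eqP: E => E; have [_ h _] := T1 _ E; move: h; rewrite /token_at; case: (sl s) => //.
    case/orP: hl => [/eqP h h'|h]; first by case: h; apply: val_inj.
    move: E (ho) => E; move: E; rewrite /target h; case: ifP => // l0.
    by move=> _ _ h'; move/negP: l0; case; apply/eqP; apply: val_inj.
  by move/eqP: E => /T2[x [b [b' [_ _ -> _]]]].
- by move=> s /T2[x [b [b' [lv h1 h2 _]]]]; rewrite /token_at h1 h2.
- move=> hh on s; case E : (target sl l live one == Some s).
    move/eqP: E => E; have [_ h _] := T1 _ E; move: h; rewrite /token_at.
    rewrite on; move/eqP: hh => ->; case: (sl s) => // -[x [|]] x1; exists x; [by left | by right].
  by move/eqP: E => /T2[x [b [b' [_ _ -> hb]]]]; exists x; left; rewrite (hb hh).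
- move=> l0; move: ho; rewrite /objects l0 /=; case: eqP => [e|_].
    by move: l0; rewrite e.
  by case: (target sl l live one) => // s _; exists s.
Qed.

Lemma count_same sl sl' y : token_at sl =1 token_at sl' -> count_at sl y = count_at sl' y.
Proof. by move=> h; apply: eq_card => s; rewrite !inE h. Qed.

Lemma count_moved sl sl' s0 x y : x != y ->
  token_at sl s0 = x -> token_at sl' s0 = y ->
  (forall s, s <> s0 -> token_at sl' s = token_at sl s) ->
  [/\ count_at sl x = (count_at sl' x).+1, count_at sl' y = (count_at sl y).+1 &
      forall w, w != x -> w != y -> count_at sl' w = count_at sl w].
Proof.
move=> xy hx hy hs.
have hD w : [set s | token_at sl s == w] :\ s0 = [set s | token_at sl' s == w] :\ s0.
  by apply/setP => s; rewrite !inE; case: eqP => //= /hs->.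
rewrite /count_at; split.
- rewrite (cardsD1 s0) inE hx eqxx hD [in RHS](cardsD1 s0) inE hy.
  by rewrite eq_sym (negbTE xy).
- rewrite (cardsD1 s0) inE hy eqxx -hD [in RHS](cardsD1 s0) inE hx.
  by rewrite (negbTE xy).
- move=> w wx wy; rewrite (cardsD1 s0) inE hy -hD [in RHS](cardsD1 s0) inE hx.
  by rewrite ![_ == w]eq_sym (negbTE wx) (negbTE wy).
Qed.

(** Pigeonhole: each full slot holds the round mark, a register token or a free token, and the first
    two kinds together are fewer than the slots. *)
Lemma free_token sl : full sl -> (forall s x b, sl s = Some (x, b) -> x != ord0) ->
  (forall s s', token_at sl s = 1 -> token_at sl s' = 1 -> s = s') ->
  \sum_(r < nr) count_at sl r.+3 + 1 < K -> exists s, token_at sl s = 2.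
Proof.
move=> hf hn hu hK; case: (pickP (fun s => token_at sl s == 2)) => [s /eqP hs|h2].
  by exists s.
suff : K <= \sum_(r < nr) count_at sl r.+3 + 1 by rewrite leqNgt hK.
have c1 : count_at sl 1 <= 1.
  by apply/card_le1_eqP => s s'; rewrite !inE => /eqP hs /eqP hs'; apply: hu.
have cE y : count_at sl y = \sum_(s < K) (token_at sl s == y).
  by rewrite /count_at -sum1_card big_mkcond; apply: eq_bigr => s _; rewrite inE; case: eqP.
apply: leq_trans (_ : \sum_(r < nr) count_at sl r.+3 + count_at sl 1 <= _); last by rewrite leq_add2l.
rewrite (eq_bigr (fun r : 'I_nr => \sum_(s < K) (token_at sl s == r.+3))) //.
rewrite exchange_big /= cE -big_split /= -[X in X <= _]card_ord -sum1_card.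
apply: leq_sum => s _; have := h2 s; have := hf s; rewrite /token_at.
case E : (sl s) => [[x b]|] // _ x2; have := hn _ _ _ E.
case: x E x2 => [[|[|[|r]]] hr] E //= _ _; first exact: leq_addl.
have hr' : r < nr by [].
by rewrite (bigD1 (Ordinal hr')) //= eqxx.
Qed.

Hypotheses (nr_gt0 : 0 < nr) (n_gt0 : 0 < n) (q_regs : uses_regs nr q).
Hypothesis run_lt : forall k, run_sum nr q n k + 1 < K.
Hypothesis load_lt : n + 1 < K.

Lemma instr_at_reg pc i : instr_at q pc = Some i -> instr_reg i < nr.
Proof.
rewrite /instr_at; case: ifP => // h [<-]; exact: (all_nthP (INC 0) q_regs).
Qed.

Lemma sum_loaded sl i : count_at sl 3 = i ->
  (forall r, 0 < r < nr -> count_at sl r.+3 = 0) -> \sum_(r < nr) count_at sl r.+3 = i.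
Proof.
move=> h0 h; rewrite (bigD1 (Ordinal nr_gt0)) //= h0 big1 ?addn0 // => r hr.
by apply: h; rewrite ltn_ord andbT lt0n.
Qed.

(* A full faithful configuration has free tokens, so a phase that waits for one cannot end the
   round without changing it. *)
Lemma no_exhaustion sl d mu z : invariant d sl mu z -> full sl ->
  copies q d 2 = None -> (forall y, 1 < y -> copies q d y <> Some 2) ->
  (forall s, exists x, sl s = Some (x, true) \/ sl s = Some (x, false) /\ x = 1 :> nat) ->
  ~ \sum_(r < nr) count_at sl r.+3 + 1 < K.
Proof.
move=> I hf hc hc' hcur.
move=> /(free_token hf (inv_nonblank I) (inv_hash_uniq I)) [s hs].
have [x [hx|[hx x1]]] := hcur s; last by move: hs; rewrite /token_at hx x1.
move: hs; rewrite /token_at hx => x2.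
have [x1|[y y1 hy]] := inv_copied I hx; first by move: x1; rewrite x2.
by apply: (hc' y y1); rewrite hy -x2.
Qed.

Lemma copies_gt1 d x y : 1 < x -> copies q d x = Some y -> 1 < y.
Proof.
move=> x1; case: d => //=; try by move=> ? [<-].
1-3: by move=> [<-].
1,3: by case: eqP => // _ [<-].
- by move=> [<-].
- by move=> pc; case: instr_at => [[r|r j]|]; try (case: eqP => // _); move=> [<-].
Qed.

Lemma advance_new d l d' : advance q d l = Some d' -> old l != ord0 -> new l != ord0.
Proof.
case/advanceP=> [->|->|->|_ h _|h|h1 h2 _] //.
- by move=> _; apply/eqP => e; rewrite e in h.
- move=> _; apply/eqP => e; move: h; rewrite e; case: d => //= pc.
  by case: instr_at => [[r|r j]|].
- by move=> _; have := copies_gt1 h1 h2; apply: contraTN => /eqP ->.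
Qed.

Lemma advance_hash d l d' : advance q d l = Some d' -> is_hash l ->
  (d = Start /\ old l = ord0) \/ old l = 1 :> nat.
Proof.
rewrite /is_hash; case/advanceP=> [->|->|->|h _ _|h|h1 h2 _] //.
- by right.
- move=> /eqP e; move: h; rewrite e; case: d => //=.
    by move=> [h _]; left; split=> //; apply: val_inj.
  by move=> pc; case: instr_at => [[r|r j]|].
- by have := copies_gt1 h1 h2 => + /eqP e; rewrite e.
Qed.

Lemma faithful_ext d sl sl' mu mu' z z' : token_at sl =1 token_at sl' ->
  (forall s, token_at sl s = 1 -> (z' - mu' s = z - mu s)%R) ->
  faithful d sl mu z -> faithful d sl' mu' z'.
Proof.
move=> ht hz; have hc y := count_same y ht.
case: d => //=.
4-5: move=> pc.
- case=> i [s [i0 hs hi hn]]; exists i, s; rewrite -ht hz //; split=> // /hn[h1 h2].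
  by rewrite -hc; split=> // r hr; rewrite -hc h2.
- case=> i [s [i0 hs hi hn]]; exists i, s; rewrite -ht hz //; split=> // /hn[h1 h2].
  by rewrite -hc; split=> // r hr; rewrite -hc h2.
- by case=> h1 h2; rewrite -hc; split=> // r hr; rewrite -hc h2.
- by case=> k [rg [h1 h2]]; exists k, rg; split=> // r hr; rewrite -hc h2.
- by case=> k [rg [h1 h2]]; exists k, rg; split=> // r hr; rewrite -hc h2.
Qed.

(** Here [i] counts the round marks since the stopwatch was started and [x] is the age of the
    current mark, so an integer reading of the stopwatch determines the number of loading rounds. *)
Lemma INR_between (i j : nat) (x : R) : (INR i - 1 < INR j - x < INR i)%R -> (0 < x < 1)%R -> i = j.
Proof.
move=> h1 h2.
have hij : (INR i < INR j.+1)%R by rewrite S_INR; lra.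
have hji : (INR j < INR i.+1)%R by rewrite S_INR; lra.
have := INR_lt _ _ hij; have := INR_lt _ _ hji; lia.
Qed.

(** * Preservation of the invariant by one accepted letter *)

Section Step.
Variables (d d' : phase) (sl : slots) (mu : 'I_K -> R) (z dt : R) (l : letter nr).
Variables (live one : 'I_K -> bool) (zn : bool).
Let nu s := (mu s + dt)%R.
Hypothesis I : invariant d sl mu z.
Hypothesis adv : advance q d l = Some d'.
Hypothesis liveP : forall s, reflect (0 < nu s < 1)%R (live s).
Hypothesis oneP : forall s, reflect (nu s = 1)%R (one s).
Hypothesis znP : reflect (z + dt = INR n)%R zn.
Hypothesis accepted : objects sl l live one zn = false.

Let tg := target sl l live one.
Let sl' := refill sl l live one.
Let mu' s := (if tg == Some s then 0 else nu s)%R.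
Let z' := (if l == watch nr then 0 else z + dt)%R.

Lemma target_ex : old l != ord0 -> exists s, tg = Some s.
Proof.
move=> l0; move: accepted; rewrite /objects l0 /=; case: eqP => [e|_].
  by move: l0; rewrite e.
by rewrite -/tg; case: tg => // s _; exists s.
Qed.

Lemma target_new s : tg = Some s -> new l != ord0.
Proof.
move=> h; case: (eqVneq (old l) ord0) => l0; last exact: (advance_new adv).
by move: h; rewrite /tg /target l0 eqxx; case: eqP.
Qed.

(** Except at the very start, a new round mark claims the previous one as its predecessor and so
    overwrites its slot; marks stay unique. *)
Lemma hash_kept s x b : is_hash l -> tg <> Some s -> keep sl l live s = Some (x, b) -> x <> 1 :> nat.
Proof.
move=> hh ts /keep_some[_ [b' [hs _]]] x1.
case: (advance_hash adv hh) => [[dS _]|o1]; first by move: hs; rewrite (inv_start I dS).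
have l0 : old l != ord0 by apply/eqP => e; rewrite e in o1.
have [s0 hs0] := target_ex l0.
have [_ h0] := target_old l0 hs0.
apply: ts; rewrite hs0; congr Some; apply: (inv_hash_uniq I); first by rewrite h0.
by rewrite /token_at hs.
Qed.

Lemma refill_cases s x b : sl' s = Some (x, b) ->
  [/\ tg = Some s, x = new l & b] \/
  [/\ tg <> Some s, live s, is_hash l -> ~~ b /\ x <> 1 :> nat &
      exists b', sl s = Some (x, b') /\ (~~ is_hash l -> b = b')].
Proof.
rewrite /sl'; case: (eqVneq tg (Some s)) => [h|/eqP h].
  by rewrite refill_target // => -[<- <-]; left.
rewrite refill_other // => hk; right; have [lv [b' [h1 [h2 h3]]]] := keep_some hk.
split=> //; last by exists b'; split=> // /negbTE hh; rewrite h2 hh andbT.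
by move=> hh; split; [rewrite h2 hh andbF | apply: hash_kept hk].
Qed.

Lemma token_one s : token_at sl' s = 1 ->
  [/\ tg = Some s & is_hash l] \/ [/\ tg <> Some s, live s, ~~ is_hash l & token_at sl s = 1].
Proof.
rewrite {1}/token_at; case E : (sl' s) => [[x b]|] // x1.
case: (refill_cases E) => [[h1 h2 _]|[h1 h2 h3 [b' [h4 _]]]].
  by left; split=> //; rewrite /is_hash -h2 x1.
right; split=> //; last by rewrite /token_at h4.
by apply/negP => /h3[].
Qed.

Lemma step_hash_uniq s s' : token_at sl' s = 1 -> token_at sl' s' = 1 -> s = s'.
Proof.
move=> /token_one[[h1 h2]|[h1 _ h2 h3]] /token_one[[k1 k2]|[k1 _ k2 k3]].
- by move: h1; rewrite k1 => -[].
- by move: h2; rewrite (negbTE k2).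
- by move: k2; rewrite (negbTE h2).
- exact: (inv_hash_uniq I).
Qed.

Lemma step_hash_current s x b : sl' s = Some (x, b) -> x = 1 :> nat -> b.
Proof.
move=> /refill_cases[[_ _ ->]//|[h1 h2 h3 [b' [h4 h5]]]] x1.
case: (boolP (is_hash l)) => [/h3[]//|hh].
by rewrite (h5 hh); apply: (inv_hash_current I h4).
Qed.

Lemma step_start : d' = Start -> forall s, sl' s = None.
Proof.
move=> d'S; have [dS lb] : d = Start /\ l = blank nr.
  case/advanceP: adv => [_ _|_ _|-> <-|_ _|h|h1 h2 e]; rewrite ?d'S //.
  - by case: (d) => //= pc; case: instr_at => [[r|r j]|].
  - by move: h; rewrite d'S; case: (d) => //= pc; case: instr_at => [[r|r j]|].
  - by move: h2; rewrite -e d'S.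
move=> s; rewrite /sl' refill_other; last by rewrite /target lb.
by rewrite /keep /age (inv_start I dS) if_same; case: (live s).
Qed.

Lemma step_older s s' x : sl' s = Some (x, false) -> token_at sl' s' = 1 -> (mu' s' < mu' s)%R.
Proof.
move=> /refill_cases[[]//|[h1 /liveP lv h3 [b' [h4 h5]]]] /token_one[[k1 k2]|[k1 _ k2 k3]].
  rewrite /mu' k1 eqxx; case: eqP => [e|_]; first by move: h1; rewrite k1 e.
  lra.
rewrite /mu'; case: eqP => // _; case: eqP => // _.
move: h4; rewrite -(h5 k2) => h4; have := inv_older I h4 k3; rewrite /nu; lra.
Qed.

Lemma step_copied s x : sl' s = Some (x, true) ->
  x = 1 :> nat \/ exists2 y, 1 < y & copies q d' y = Some (x : nat).
Proof.
case/refill_cases=> [[h1 -> _]|[h1 _ h3 [b' [h4 h5]]]].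
  case/advanceP: adv => [e _ _|e _ _|e _|_ h _|h|k1 k2 ->]; try by have := target_new h1; rewrite e.
  - by left.
  - case: (d) h => //=; try (move=> [_ <- <-]).
    + by left.
    + by right; exists 2.
    + by right; exists 3.
    + by right; exists 3.
    + move=> pc; case: instr_at => [[r|r j]|] // [_ <- <-]; right; [by exists r.+3 | by exists 2].
  - by right; exists (old l).
have hh : ~~ is_hash l by apply/negP => /h3[].
move: h4; rewrite -(h5 hh) => /[dup] h4 /(inv_copied I)[|[y y1 hy]]; first by left.
have x1 := copies_gt1 y1 hy; right.
case/advanceP: adv => [_ e ->|_ e ->|_ ->|_ e _|h|_ _ ->]; try by exists y; rewrite // -hy e.
- by move: hh; rewrite /is_hash e.
- case: (d) (inv_start I) h hy => //=; try (move=> hst [_ _ <-] hy).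
  + by exists y.
  + by exists x.
  + by exists x.
  + by move=> pc hst; case: instr_at => [[r|r j]|] // [_ _ <-] hy; exists x.
Qed.

Lemma step_watch : d' = Grow1 \/ d' = Grow2 -> forall s, token_at sl' s = 1 ->
  (-1 < z' - mu' s < 0)%R.
Proof.
move=> hd s /token_one[[h1 hh]|[h1 /liveP lv hh h3]].
  case/advanceP: adv => [e _ _|e _ _|e _|_ _ h|h|k1 k2 _];
    try by move: hh; rewrite /is_hash e.
  - by move: h; case: hd => ->; case: (d) => //= pc; case: instr_at => [[r|r j]|].
  - move: h; move/eqP: hh => ->; case: hd => ->; case: (d) => //= pc.
      by case: instr_at => [[r|r j]|].
    by case: instr_at => [[r|r j]|].
  - by have := copies_gt1 k1 k2; move/eqP: hh => ->.
have -> : mu' s = nu s by rewrite /mu'; case: eqP.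
rewrite /z'; case: eqP => [_|/eqP lw]; first lra.
have dd : d = Grow1 \/ d = Grow2.
  case/advanceP: adv => [e|_ _ e|_ <-|_ _ h|h|_ _ <-] //.
  - by move: lw; rewrite e eqxx.
  - by move: hd; rewrite e => -[].
  - by move: h; case: hd => ->; case: (d) => //= pc; case: instr_at => [[r|r j]|].
  - by case: hd => e; move: h; rewrite e; case: (d) => //=; try (by left); move=> pc;
      case: instr_at => [[r|r j]|].
have := inv_watch I dd h3; rewrite /nu; lra.
Qed.

Lemma count0 y : full sl -> (forall s x b, sl s = Some (x, b) -> x <> y :> nat) -> count_at sl y = 0.
Proof.
move=> hf h; apply: eq_card0 => s; rewrite !inE /token_at.
by case E : (sl s) (hf s) => [[x b]|] // _; apply/eqP; apply: h E.
Qed.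

Lemma step_blank : old l = ord0 -> new l = ord0 -> full sl' ->
  [/\ full sl, token_at sl =1 token_at sl', forall s, live s & mu' =1 nu].
Proof.
move=> o0 n0 hf; have nt s : tg <> Some s by rewrite /tg /target o0 n0 eqxx.
have [|hfs h1 _ _ _] := full_refill hf _ accepted; first by rewrite n0 eqxx orbT.
split=> // [s|s|s]; [by have [] := h1 _ (nt s) | by have [] := h1 _ (nt s) |].
by rewrite /mu'; case: eqP => // /nt.
Qed.

Lemma step_hash : old l = 1 :> nat -> new l = 1 :> nat -> full sl' ->
  [/\ full sl, token_at sl =1 token_at sl',
    forall s, token_at sl s = 1 -> (nu s = 1 /\ mu' s = 0)%R,
    exists s, token_at sl' s = 1 &
    forall s, exists x, sl s = Some (x, true) \/ sl s = Some (x, false) /\ x = 1 :> nat].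
Proof.
move=> o1 n1 hf.
have l0 : old l != ord0 by apply/eqP => e; rewrite e in o1.
have [|hfs h1 h2 h3 h4] := full_refill hf _ accepted; first by rewrite l0.
have [s0 hs0] := h4 l0; have [/oneP o0 t0 t0'] := h2 _ hs0.
split=> //.
- move=> s; case: (eqVneq tg (Some s)) => [/h2[_ -> ->]|/eqP/h1[_ ->]//].
  by rewrite o1 n1.
- move=> s s1; have <- : s0 = s by apply: (inv_hash_uniq I) => //; rewrite t0.
  by split=> //; rewrite /mu' /tg hs0 eqxx.
- by exists s0; rewrite t0'.
- apply: h3; first by rewrite /is_hash n1.
  by apply: val_inj; rewrite /= o1 n1.
Qed.

Lemma step_change x y : old l = x :> nat -> new l = y :> nat -> 1 < x -> x != y -> full sl' ->
  [/\ full sl, count_at sl x = (count_at sl' x).+1, count_at sl' y = (count_at sl y).+1,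
    forall w, w != x -> w != y -> count_at sl' w = count_at sl w &
    forall s, token_at sl s = 1 -> token_at sl' s = 1 /\ mu' s = nu s].
Proof.
move=> ox ny x1 xy hf.
have l0 : old l != ord0 by apply/eqP => e; rewrite -ox e in x1.
have [|hfs h1 h2 _ h4] := full_refill hf _ accepted; first by rewrite l0.
have [s0 hs0] := h4 l0; have [_ t0 t0'] := h2 _ hs0.
have h1' s : s <> s0 -> token_at sl' s = token_at sl s.
  by move=> ss; have [|] := h1 s => //; rewrite hs0 => -[e]; apply: ss.
rewrite ox in t0; rewrite ny in t0'.
have [c1 c2 c3] := count_moved xy t0 t0' h1'.
split=> // s s1; have ss : s <> s0 by move=> e; move: x1; rewrite -t0 -e s1.
rewrite h1' // /mu'; split=> //; case: eqP => //.
by rewrite /tg hs0 => -[e]; case: ss.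
Qed.

Lemma step_copy : 1 < old l -> old l = new l -> full sl' ->
  [/\ full sl, token_at sl =1 token_at sl' & forall s, token_at sl s = 1 -> mu' s = nu s].
Proof.
move=> o1 on hf.
have l0 : old l != ord0 by apply/eqP => e; rewrite e in o1.
have [|hfs h1 h2 _ h4] := full_refill hf _ accepted; first by rewrite l0.
split=> // s; first by case: (eqVneq tg (Some s)) => [/h2[_ -> ->]|/eqP/h1[_ ->]//]; rewrite on.
by move=> s1; rewrite /mu'; case: eqP => // /h2[_ h _]; move: o1; rewrite -h s1.
Qed.

Lemma not_watch : old l != ord0 -> z' = (z + dt)%R.
Proof. by move=> l0; rewrite /z'; case: eqP => // e; move: l0; rewrite e. Qed.

(** Full slots after the letter mean that nothing was lost, so each letter has its intended effect
    on the simulation. At a round mark, a phase that waits for a free token contradicts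
    [no_exhaustion]; this is what makes [Grow0] unreachable with full slots. *)
Lemma step_faithful : full sl' -> faithful d' sl' mu' z'.
Proof.
move=> hf; case/advanceP: adv => [e dE ->|e dE ->|e ->|o1 n1 hd|hd|o1 hc ->].
- have [||hfs _ _ _] := step_blank _ _ hf; rewrite ?e //.
  by have := inv_full I hfs; rewrite dE.
- have [||hfs ht lv hm] := step_blank _ _ hf; rewrite ?e //.
  have := inv_full I hfs; rewrite dE /= => -[i [s [i0 s1 hi hn]]].
  have zE : (z + dt = INR n)%R.
    by apply/znP; move: accepted; rewrite /objects e eqxx; case: (zn).
  have /liveP hs := lv s.
  have ein : i = n.
    by apply: (@INR_between i n (nu s)) => //; rewrite -zE /nu; lra.
  have [|h1 h2] := hn; first by rewrite ein.
  rewrite -!(count_same _ ht) h1 ein; split=> // r hr.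
  by rewrite -(count_same _ ht) h2.
- have [||hfs ht lv hm] := step_blank _ _ hf; rewrite ?e //.
  apply: faithful_ext ht _ (inv_full I hfs) => s _.
  by rewrite hm /z' /nu e /=; lra.
- have [hfs ht hh [s0 hs0] hcur] := step_hash o1 n1 hf.
  have l0 : old l != ord0 by apply/eqP => e; rewrite e in o1.
  have zE := not_watch l0.
  have cs y := count_same y ht.
  have zs s : token_at sl s = 1 -> (z' - mu' s = z - mu s + 1)%R.
    by move=> /hh[+ ->]; rewrite zE /nu; lra.
  have F := inv_full I hfs.
  have NE := no_exhaustion I hfs.
  case: (d) I F NE hd => //=.
  (* The stopwatch was started less than one unit after the previous mark, hence reads between 0 and
     1 at this one. All tokens of the round were copied or created as free, so the registers are
     empty. *)
  + move=> I' _ _ [<-] /=; exists 1, s0; split=> //.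
      have h0 : token_at sl s0 = 1 by rewrite ht.
      have := inv_watch I' (or_intror (erefl _)) h0; rewrite zs //=; lra.
    move=> _; have c0 r : count_at sl' r.+3 = 0.
      rewrite -cs; apply: count0 => // s x b hs xr.
      have [x' [hx|[hx x1]]] := hcur s; move: (hx); rewrite hs => -[e _]; last first.
        by move: x1; rewrite -e xr.
      have [x1|[y _ [y2]]] := inv_copied I' hx; first by move: x1; rewrite -e xr.
      by move: y2; rewrite -e xr.
    by split=> // r _; apply: c0.
  + move=> I' [i [s [i0 s1 hi hn]]] NE [<-] /=; exists i.+1, s; split=> //.
    * by rewrite -ht.
    * by rewrite zs // S_INR; lra.
    * move=> hin; case: NE => //; first by move=> y _; case: eqP => // ye [].
      have [|c1 c2] := hn; first exact: ltnW.
      by rewrite (sum_loaded c1 c2); lia.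
  + move=> I' [i [s [i0 s1 hi hn]]] _ [<-] /=; exists i.+1, s; split=> //.
    * by rewrite -ht.
    * by rewrite zs // S_INR; lra.
    * move=> hin; have [|c1 c2] := hn; first exact: ltnW.
      by rewrite -cs c1; split=> // r hr; rewrite -cs c2.
  + move=> I' [c1 c2] NE [<-] /=; apply: NE => //; first by move=> y _; case: eqP => // ye [].
    by rewrite (sum_loaded c1 c2); lia.
  + move=> pc I' [k [rg [hk hr]]] NE; case E : (instr_at q pc) NE => [[r|r j]|] //= NE [<-] /=.
      apply: NE => //; first by move=> y _; case: eqP => // ye [].
      rewrite (eq_bigr (fun r : 'I_nr => rg r)); last by move=> r' _; apply: hr.
      by have := run_lt k; rewrite /run_sum hk.
    have rR := instr_at_reg E; simpl in rR.
    (* At the end of the round every token except the mark is a copy made in this phase, and the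
       phase yields no token of register [r]. *)
    have r0 : rg r = 0.
      rewrite -hr //; apply: count0 => // s x b hs xr.
      have [x' [hx|[hx x1]]] := hcur s; move: (hx); rewrite hs => -[e _]; last first.
        by move: x1; rewrite -e xr.
      have [x1|[y _]] := inv_copied I' hx; first by move: x1; rewrite -e xr.
      by rewrite /= E; case: eqP => // ye [yx]; apply: ye; rewrite yx -e xr.
    exists k.+1, rg; split; last by move=> r' hr'; rewrite -cs hr.
    rewrite iterS hk /step; move: E; rewrite /instr_at; case: ifP => // _ [->].
    by rewrite r0.
  + move=> pc I' [k [rg [hk hr]]] _ [<-] /=; exists k, rg; split=> // r hr'.
    by rewrite -cs hr.
- have F := inv_full I; have St0 := inv_start I.
  case: (d) F St0 hd => //=.
  + move=> _ St0 [o0 n1 <-] /=.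
    have l0 : old l = ord0 by apply: val_inj.
    (* The first mark occupies one slot; a second slot stays empty, so the slots are not full. *)
    have K1 : 1 < K by apply: leq_ltn_trans load_lt; rewrite addn1.
    have [s hs] : exists s, tg <> Some s.
      case: tg => [s|]; last by exists (Ordinal (ltnW K1)).
      case: (eqVneq (s : nat) 0) => h0; [exists (Ordinal K1)|exists (Ordinal (ltnW K1))].
        by move=> [e]; move: h0; rewrite e.
      by move=> [e]; move: h0; rewrite e.
    have := hf s; rewrite /sl' refill_other // /keep St0 // /age.
    by rewrite if_same; case: (live s).
  + by move=> _ _ [_ _ <-].
  + move=> F _ [o2 n3 <-]; have [//|//|hfs c1 c2 c3 hs1] := step_change (esym o2) (esym n3) _ _ hf.
    have [i [s [i0 s1 hi hn]]] := F hfs; have [s1' ms] := hs1 s s1.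
    exists i, s; split=> //.
      by rewrite ms not_watch /nu; [lra | apply/eqP => e; rewrite e in o2].
    move=> /hn[d1 d2]; rewrite c2 d1 prednK //; split=> // r hr.
    by rewrite c3 ?d2 //; lia.
  + move=> F _ [o2 n3 <-]; have [//|//|hfs c1 c2 c3 hs1] := step_change (esym o2) (esym n3) _ _ hf.
    have [d1 d2] := F hfs; exists 0, (init_config n).2; split=> // r hr /=.
    case: eqP => [->|r0]; first by rewrite c2 d1 prednK.
    by rewrite c3 ?d2 //; lia.
  + move=> pc F _; case E : (instr_at q pc) F => [[r|r j]|] //= F [ox ny <-].
      have [//|//|hfs c1 c2 c3 _] := step_change (esym ox) (esym ny) _ _ hf.
      have [k [rg [hk hr]]] := F hfs; exists k.+1, (update rg r (rg r).+1).
      have rR := instr_at_reg E; simpl in rR.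
      split.
        rewrite iterS hk /step; move: E; rewrite /instr_at; case: ifP => // _ [->].
        by [].
      move=> r' hr'; rewrite /update; case: eqP => [->|rr]; first by rewrite c2 hr.
      by rewrite c3 ?hr //; lia.
    have [//|//|hfs c1 c2 c3 _] := step_change (esym ox) (esym ny) _ _ hf.
    have [k [rg [hk hr]]] := F hfs; exists k.+1, (update rg r (rg r).-1).
    have rR := instr_at_reg E; simpl in rR.
    have rg0 : rg r = (count_at sl' r.+3).+1 by rewrite -hr.
    split.
      rewrite iterS hk /step; move: E; rewrite /instr_at; case: ifP => // _ [->].
      by rewrite rg0.
    move=> r' hr'; rewrite /update; case: eqP => [->|rr]; first by rewrite rg0.
    by rewrite c3 ?hr //; lia.
- have l0 : old l != ord0 by apply/eqP => e; rewrite e in o1.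
  (* Only the growing phases change the type in a copy, and there faithfulness is trivially false or
     trivially true. *)
  have gr : faithful d sl mu z -> faithful d sl' mu' z' \/ copies q d (old l) = Some (old l : nat).
    case: (d) hc => //=; try (by right); try (by left); try (by case: eqP => //; right).
    by move=> pc; case: instr_at => [[r|r j]|]; try (case: eqP => //); right.
  have nz : new l != ord0 by have := copies_gt1 o1 hc; apply: contraTN => /eqP ->.
  have hfs : full sl by have [|//] := full_refill hf _ accepted; rewrite l0.
  case: (gr (inv_full I hfs)) => // hc'.
  have on : old l = new l by move: hc'; rewrite hc => -[e]; apply: val_inj.
  have [_ ht hs] := step_copy o1 on hf.
  apply: faithful_ext ht _ (inv_full I hfs) => s s1.
  by rewrite hs // not_watch // /nu; lra.
Qed.

Lemma invariant_step : invariant d' sl' mu' z'.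
Proof.
split.
- move=> s x b /refill_cases[[h1 -> _]|[_ _ _ [b' [h4 _]]]]; first exact: target_new h1.
  exact: (inv_nonblank I h4).
- exact: step_hash_uniq.
- exact: step_hash_current.
- exact: step_start.
- exact: step_older.
- exact: step_copied.
- exact: step_watch.
- exact: step_faithful.
Qed.

End Step.

(** * The controller, and the impossibility of an accepting run against it *)

Definition encode_phase (d : phase) : option 'I_(size (phases q)) := insub (index d (phases q)).

Definition ctrl_loc := option ('I_(size (phases q)) * slots).

(** Clock [ord0] is the stopwatch; [lift ord0 s] is the clock of slot [s]. *)
Definition resets (l : letter nr) (t : option 'I_K) : {set 'I_K.+1} :=
  [set x | (x == ord0) && (l == watch nr) || (omap (lift ord0) t == Some x)].

(** The location [None] is entered once the play is decided, by an objection or a broken rule; no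
    run of the automaton survives either, so the answers there are arbitrary. *)
Definition ctrl_move (c : ctrl_loc) (l : letter nr) (live one : {ffun 'I_K -> bool}) (zn : bool) :
    ctrl_loc * 'I_2 * {set 'I_K.+1} :=
  if c is Some (i, sl) then
    if advance q (nth Start (phases q) i) l is Some d' then
      let ob := objects sl l live one zn in
      (if ob then None else omap (fun j => (j, refill sl l live one)) (encode_phase d'),
       if ob then ord_max else ord0, resets l (target sl l live one))
    else (None, ord0, set0)
  else (None, ord0, set0).

Definition live_of (nu : 'I_K.+1 -> R) : {ffun 'I_K -> bool} :=
  [ffun s => rltb 0 (nu (lift ord0 s)) && rltb (nu (lift ord0 s)) 1].
Definition one_of (nu : 'I_K.+1 -> R) : {ffun 'I_K -> bool} :=
  [ffun s => reqb (nu (lift ord0 s)) 1].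

Definition ctrl_delta (c : ctrl_loc) (a : 'I_#|{: letter nr}|) (nu : 'I_K.+1 -> R) :=
  ctrl_move c (enum_val a) (live_of nu) (one_of nu) (reqb (nu ord0) (INR n)).

Lemma ctrl_delta_region c a nu nu' : region_equiv n.+1 nu nu' -> ctrl_delta c a nu = ctrl_delta c a nu'.
Proof.
move=> h.
have hgt x : rltb 0 (nu x) = rltb 0 (nu' x).
  have := h x None op_gt (Posz 0) isT; rewrite /csat /cmp_sat /= !Rminus_0_r => hx.
  by apply/rltbP/rltbP; case: hx; rewrite /Rgt.
have hlt x : rltb (nu x) 1 = rltb (nu' x) 1.
  have := h x None op_lt (Posz 1) isT; rewrite /csat /cmp_sat /= !Rminus_0_r => hx.
  by apply/rltbP/rltbP; case: hx.
have heq x k : k <= n.+1 -> reqb (nu x) (INR k) = reqb (nu' x) (INR k).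
  move=> hk; have := h x None op_eq (Posz k) hk; rewrite /csat /cmp_sat /= !Rminus_0_r => hx.
  by apply/reqbP/reqbP; case: hx.
rewrite /ctrl_delta heq //; congr ctrl_move; apply/ffunP => s; rewrite !ffunE ?hgt ?hlt //.
exact: (heq _ 1).
Qed.

(** Clocks are compared only with 0, 1 and n, all within the region bound [n.+1]. *)
Definition slot_controller : controller #|{: letter nr}| 2 K.+1 n.+1 :=
  @Controller _ _ _ _ ctrl_loc
    (omap (fun j => (j, [ffun => None])) (encode_phase Start)) ctrl_delta ctrl_delta_region.

(** What the clock [x] of a run knows about the slots reset at the same moment. For a guessed token
    the first clause excludes wrong silence, the second a wrong objection. *)
Definition linked (ph : option (option (token nr))) (x : R) (sl : slots) (mu : 'I_K -> R) (z : R) :=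
  match ph with
  | None => True
  | Some None => z = x
  | Some (Some y) =>
      (forall s, sl s <> None -> mu s = x -> token_at sl s = y) /\
      (y <> ord0 -> exists2 s, sl s <> None & mu s = x)
  end.

Lemma edge_cases e d ph : e \in all_edges nr q n -> e_src e = Some (d, ph) ->
  [/\ d \in phases q, exists d', advance q d (e_letter e) = Some d' &
      e = expire_edge nr n \/ e \in out_edges q d (e_letter e) ph].
Proof.
case/edgeP=> [l b|[<- <-]|d0 l ph0 {}e hd he] //.
  by split; [|exists LoadLast|left].
move: (he); rewrite /out_edges; case E : advance => [d'|] // h hs.
have [es el] : e_src e = Some (d0, ph0) /\ e_letter e = l.
  move: h; case: (ph0) => [[x|]|].
  - by rewrite inE => /orP[/eqP->//|]; case: ifP => //; rewrite inE => _ /eqP->.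
  - by case: ifP => //; rewrite inE => _ /eqP->.
  - rewrite !mem_cat => /or3P[|//|].
    + by rewrite !inE => /orP[]/eqP->.
    + by case: ifP => //; rewrite inE => _ /eqP->.
    + by case: ifP => //; rewrite inE => _ /eqP->.
move: hs; rewrite es => -[<- <-]; rewrite el; split=> //; first by exists d'.
by right.
Qed.

Section Edge.
Variables (d d' : phase) (sl : slots) (mu : 'I_K -> R) (z dt x : R) (e : edge nr).
Variables (live one : 'I_K -> bool) (zn : bool) (ph : option (option (token nr))).
Let nu s := (mu s + dt)%R.
Let l := e_letter e.
Hypothesis I : invariant d sl mu z.
Hypothesis adv : advance q d l = Some d'.
Hypothesis liveP : forall s, reflect (0 < nu s < 1)%R (live s).
Hypothesis oneP : forall s, reflect (nu s = 1)%R (one s).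
Hypothesis znP : reflect (z + dt = INR n)%R zn.
Hypothesis eE : e = expire_edge nr n \/ e \in out_edges q d l ph.
Hypothesis eS : e_src e = Some (d, ph).
Hypothesis lk : linked ph x sl mu z.
Hypothesis ht : test_sat (e_test e) (x + dt)%R.
Hypothesis ans : e_answer e = objects sl l live one zn.

Let tg := target sl l live one.
Let mu' s := (if tg == Some s then 0 else nu s)%R.
Let z' := (if l == watch nr then 0 else z + dt)%R.

(** Tokens are created only in [Start] and [Grow1], where [inv_full] forbids full slots. *)
Lemma creation_target : objects sl l live one zn = false -> new l != ord0 -> exists s, tg = Some s.
Proof.
move=> ob n0; case: (eqVneq (old l) ord0) => [o0|o0]; last exact: target_ex ob o0.
rewrite /tg /target o0 eqxx (negbTE n0); case: pickP => [s _|hk]; first by exists s.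
have hf : full sl.
  move=> s hs; have := hk s; rewrite /keep hs /age.
  by rewrite if_same; case: (live s).
have F := inv_full I hf.
have hd : d = Start \/ d = Grow1.
  case/advanceP: adv => [le|le|le|o1|hc|o1]; try by move: n0; rewrite le.
  - by move: o1; rewrite o0.
  - move: hc; rewrite o0 /=; case: (d) => //=; try (by left); try (by right).
    by move=> pc; case: instr_at => [[r|r j]|].
  - by move: o1; rewrite o0.
by case: hd => h; move: F; rewrite h.
Qed.

Lemma kept_token s : refill sl l live one s <> None -> tg <> Some s ->
  [/\ live s, sl s <> None & token_at (refill sl l live one) s = token_at sl s].
Proof.
move=> + ts; rewrite /token_at refill_other //.
by case E : keep => [[y b]|] // _; have [lv [b' [-> _]]] := keep_some E.
Qed.

(** Ageing never removes a live token: at a round mark the previous mark has clock 1, and what is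
    older has a larger clock. The written slot is not live either, being empty or at clock 1. *)
Lemma live_kept s : objects sl l live one zn = false -> sl s <> None -> live s ->
  refill sl l live one s <> None /\ tg <> Some s.
Proof.
move=> ob hs lv.
have kN : keep sl l live s <> None.
  rewrite /keep lv /age; case: ifP => // hh.
  case E : (sl s) => [[y [|]]|] //.
  case: (advance_hash adv hh) => [[dS _]|o1]; first by move: E; rewrite (inv_start I dS).
  have l0 : old l != ord0 by apply/eqP => e0; rewrite e0 in o1.
  have [s0 hs0] := target_ex ob l0; have [/oneP h1 h2] := target_old l0 hs0.
  have := inv_older I E (etrans h2 o1); have /liveP := lv.
  by move: h1; rewrite /nu; lra.
have ts : tg <> Some s.
  rewrite /tg /target; case: ifP => o0.
    case: ifP => // n0.
    by case: pickP => // s' /eqP h [e0]; case: kN; rewrite -e0.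
  case: pickP => // s' /andP[/oneP h1 _] [e0]; have /liveP := lv; rewrite -e0; lra.
by split=> //; rewrite refill_other.
Qed.

Lemma edge_linked : exists ph', [/\ e_tgt e = Some (d', ph'), objects sl l live one zn = false &
  linked ph' (if e_reset e then 0 else x + dt)%R (refill sl l live one) mu' z'].
Proof.
case: eE => [eE'|].
  move: eS lk ht ans; rewrite /l eE' /= => -[_ <-] /= zx hz.
  rewrite /objects eqxx => /esym/negP[]; apply/znP.
  by rewrite zx.
rewrite /out_edges adv; case: ph lk => [[y|]|] lk'.
- rewrite inE => /orP[/eqP eE'|].
    move: ht ans; rewrite eE' /= => hx /esym ob; exists (Some (Some y)); split=> //.
    case: lk' => h1 h2; split.
    + move=> s hs; rewrite /mu'; case: eqP => [_|ts]; first by move=> e0; move: hx; rewrite -e0; lra.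
      have [_ hs' ->] := kept_token hs ts; move=> nx; apply: h1 => //.
      by move: nx; rewrite /nu; lra.
    + move=> y0; have [s hs sx] := h2 y0.
      have lv : live s by apply/liveP; rewrite /nu sx.
      have [hs' ts] := live_kept ob hs lv; exists s => //.
      by rewrite /mu'; case: eqP => // _; rewrite /nu sx.
  case: eqP => // /eqP o0; rewrite inE => /eqP eE'.
  have le : l != expire nr by apply/eqP => le; move: o0; rewrite le.
  move: ht ans; rewrite eE' /= => hx; rewrite /objects (negbTE le) o0 /=.
  rewrite -/tg; case: lk' => h1 h2.
  case: (eqVneq (old l) y) => [oy|oy] /esym.
    move/eqP; rewrite /tg /target (negbTE o0); case: pickP => // hk _.
    have [s hs sx] : exists2 s, sl s <> None & mu s = x by apply: h2; rewrite -oy; apply/eqP.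
    have /negP[] := negbT (hk s); apply/andP; split; first by apply/oneP; rewrite /nu sx hx.
    by apply/eqP; rewrite h1 // oy.
  case E : tg => [s|] // _; have [/oneP h3 h4] := target_old o0 E.
  have hs : sl s <> None.
    by move=> hs; move: h4 o0; rewrite /token_at hs => h4; rewrite -val_eqE /= -h4.
  case/eqP: oy; apply: val_inj; rewrite /= -h4; apply: h1 => //.
  by move: h3 hx; rewrite /nu /=; lra.
- case: eqP => // lw; rewrite inE => /eqP eE'.
  move: ans; rewrite eE' /= => /esym ob; exists (Some None); split=> //.
  by rewrite /z' /=; case: eqP => // _; rewrite lk'.
- rewrite !mem_cat => /or3P[|//|].
  + rewrite !inE => /orP[/eqP eE'|/eqP eE']; move: ans; rewrite eE' /= => /esym ob.
      by exists None.
    exists (Some (Some (new l))); split=> //; split.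
      move=> s hs; rewrite /mu'; case: eqP => [ts _|ts]; first by rewrite /token_at refill_target.
      by have [/liveP + _ _] := kept_token hs ts => + h0; rewrite h0; lra.
    move/eqP => n0; have [s hs] := creation_target ob n0; exists s.
      by rewrite refill_target.
    by rewrite /mu' hs eqxx.
  + case: eqP => // lw; rewrite inE => /eqP eE'.
    move: ans; rewrite eE' /= => /esym ob; exists (Some None); split=> //.
    by rewrite /z' /= lw eqxx.
  + case: andP => // -[/eqP o0 le]; rewrite inE => /eqP eE'.
    by move: ans; rewrite eE' /= /objects (negbTE le) o0 eqxx.
Qed.

End Edge.

Lemma encode_phaseK d : d \in phases q ->
  exists2 i, encode_phase d = Some i & nth Start (phases q) i = d.
Proof.
rewrite -index_mem => h; exists (Ordinal h); first by rewrite /encode_phase insubT.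
by rewrite nth_index // -index_mem.
Qed.

Theorem slot_controller_winning : winning slot_controller (accepts (reduction nr q n).2).
Proof.
move=> a t t0 tinc.
pose l i := enum_val (a i) : letter nr.
pose b i := ctrl_answer slot_controller a t i == 1 :> nat.
move=> /(accepts_edges (play_word slot_controller a t)) [e [v [e0 v0 [N hN] he]]].
suff H i : exists d ph j sl mu, [/\ e_src (e i) = Some (d, ph),
    ctrl_state slot_controller a t i = (Some (j, sl), mu), nth Start (phases q) j = d,
    invariant d sl (fun s => mu (lift ord0 s)) (mu ord0) &
    linked ph (v i) sl (fun s => mu (lift ord0 s)) (mu ord0)].
  have [d [ph [j [sl [mu [h _ _ _ _]]]]]] := H N.+1.
  by have [_ hn _ _ _] := he N; move: h; rewrite hn hN.
elim: i => [|i [d [ph [j [sl [mu [es cs jd I lk]]]]]]].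
  have [|j hj jd] := @encode_phaseK Start; first by rewrite mem_head.
  exists Start, None, j, [ffun => None], (fun _ => R0); rewrite e0; split=> //.
    by rewrite /= hj.
  split; rewrite /token_at.
  - by move=> s x b'; rewrite ffunE.
  - by move=> s s'; rewrite ffunE.
  - by move=> s x b'; rewrite ffunE.
  - by move=> _ s; rewrite ffunE.
  - by move=> s s' x; rewrite ffunE.
  - by move=> s x; rewrite ffunE.
  - by case.
  - have K0 : 0 < K by apply: leq_ltn_trans load_lt.
    by move=> /(_ (Ordinal K0)); rewrite ffunE.
have [eA en [el eb] et ev] := he i.
have [hd [d' adv] eE] := edge_cases eA es.
have [_ hn' _ _ _] := he i.
pose dt := (t i - prev_time t i)%R.
pose nu x := (mu x + dt)%R.
pose ob := objects sl (l i) (live_of nu) (one_of nu) (reqb (nu ord0) (INR n)).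
have lv s : reflect (0 < mu (lift ord0 s) + dt < 1)%R (live_of nu s).
  rewrite ffunE -/(nu _); apply: (iffP andP) => [[/rltbP h1 /rltbP h2]|[h1 h2]]; first by split.
  by split; apply/rltbP.
have on s : reflect (mu (lift ord0 s) + dt = 1)%R (one_of nu s).
  by rewrite ffunE; apply: reqbP.
have cm : ctrl_delta (Some (j, sl)) (a i) nu =
    (if ob then None else omap (fun j => (j, refill sl (l i) (live_of nu) (one_of nu))) (encode_phase d'),
     if ob then ord_max else ord0, resets (l i) (target sl (l i) (live_of nu) (one_of nu))).
  by rewrite /ctrl_delta /ctrl_move jd -/(l i); move: adv; rewrite el => ->.
have bE : b i = ob.
  have -> : b i = ((ctrl_delta (Some (j, sl)) (a i) nu).1.2 == 1 :> nat).
    by rewrite /b /ctrl_answer cs.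
  by rewrite cm /=; case: (ob).
have [|ph' [tE obF lk']] := @edge_linked d d' sl (fun s => mu (lift ord0 s)) (mu ord0) dt (v i)
  (e i) (live_of nu) (one_of nu) (reqb (nu ord0) (INR n)) ph I adv lv on (reqbP _ _) eE es lk et.
  by rewrite eb -/(b i) bE el.
have sn : e_src (e i.+1) = Some (d', ph') by rewrite en tE.
(* That [d'] has a code follows from the run itself: its next rule starts in [d'], and rules start
   only in [phases q]. *)
have [eA' _ _ _ _] := he i.+1.
have [hd' _ _] := edge_cases eA' sn.
have [j' hj' jd'] := encode_phaseK hd'.
rewrite el in adv obF lk'.
have obE : ob = false by [].
exists d', ph', j', (refill sl (l i) (live_of nu) (one_of nu)),
  (fun x => if x \in resets (l i) (target sl (l i) (live_of nu) (one_of nu)) then R0 else nu x).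
have r0 : (ord0 \in resets (l i) (target sl (l i) (live_of nu) (one_of nu))) = (l i == watch nr).
  rewrite inE eqxx /=; case: (target _ _ _ _) => [s|]; rewrite /= ?orbF //.
have rs s : (lift ord0 s \in resets (l i) (target sl (l i) (live_of nu) (one_of nu))) =
    (target sl (l i) (live_of nu) (one_of nu) == Some s).
  rewrite inE eq_sym (negbTE (neq_lift _ _)) /=; case: (target _ _ _ _) => [s'|] //.
have muE : (fun s => if lift ord0 s \in resets (l i) (target sl (l i) (live_of nu) (one_of nu))
    then R0 else nu (lift ord0 s)) =
  (fun s => (if target sl (l i) (live_of nu) (one_of nu) == Some s then 0
    else mu (lift ord0 s) + dt)%R) by apply: functional_extensionality => s; rewrite rs.
split=> //.
- have -> : ctrl_state slot_controller a t i.+1 =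
    (let: (c', _, Y) := ctrl_delta (Some (j, sl)) (a i) nu in
     (c', fun x => if x \in Y then R0 else nu x)) by rewrite /= cs.
  by rewrite cm obE hj'.
- rewrite muE r0; exact: (invariant_step I adv lv on (reqbP _ _) obF).
- by rewrite muE r0 ev.
Qed.

End Controller.

Theorem bounded_run_synth nr q n : 0 < nr -> 0 < n -> uses_regs nr q ->
  bounded_run nr q n -> synth_problem (reduction nr q n).
Proof.
(* Large enough that neither [B] simulated tokens nor [n] loaded ones, together with the round mark,
   fill all slots. *)
move=> nr0 n0 qr [B hB]; pose K := B + n + 2.
exists K.+1, n.+1, (@slot_controller nr q n K).
apply: slot_controller_winning => // [k|]; last by rewrite /K; lia.
by have := hB k; rewrite /K; lia.
Qed.

(** * Spoiling plays for unbounded runs *)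

Section Paths.
Variables (nr : nat) (q : program) (n : nat).
Variables (l : nat -> letter nr) (b : nat -> bool) (T : nat -> R) (dst : nat -> phase) (e : nat).
Hypothesis dst0 : dst 0 = Start.
Hypothesis dstP : forall i, i <= e -> dst i \in phases q /\ advance q (dst i) (l i) = Some (dst i.+1).
Hypothesis ok : forall i, i < e -> b i = false.

Let path := path_to q n l b T.

Lemma path_plain i : i <= e -> exists x, path i (Some (dst i, None)) x.
Proof.
elim: i => [|i IH] hi; first by rewrite dst0; exists R0; apply: PathNil.
have [x hx] := IH (ltnW hi); have [hd ha] := dstP (ltnW hi).
eexists; apply: (@PathStep _ _ _ _ _ _ _ _ _ (Some (dst i, None), l i, false, None, false,
  Some (dst i.+1, None)) hx) => //; last by rewrite ok.
by rewrite inE (out_edges_mem (d := dst i) (l := l i) (ph := None)) ?orbT // /out_edges ha inE eqxx.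
Qed.

Lemma path_guess e0 j : e0 < j <= e ->
  (forall i, e0 < i < j -> (0 < T i - T e0 < 1)%R) ->
  path j (Some (dst j, Some (Some (new (l e0))))) (T j.-1 - T e0)%R.
Proof.
elim: j => // j IH /andP[hj je] hT; have [hd ha] := dstP (ltnW je).
move: hj; rewrite ltnS leq_eqVlt => /orP[/eqP ej|hj].
  subst j; have [x hx] := path_plain (ltnW je); rewrite /= Rminus_diag.
  apply: (@PathStep _ _ _ _ _ _ _ _ _ (Some (dst e0, None), l e0, false, None, true,
    Some (dst e0.+1, Some (Some (new (l e0))))) hx) => //; last by rewrite ok.
  rewrite inE (out_edges_mem (d := dst e0) (l := l e0) (ph := None)) ?orbT //.
  by rewrite /out_edges ha !inE eqxx orbT.
have hx := IH _ _; have {hx} hx : path j (Some (dst j, Some (Some (new (l e0))))) (T j.-1 - T e0)%R.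
  by apply: hx => [|i /andP[h1 h2]]; [rewrite hj ltnW | apply: hT; rewrite h1 /= ltnW].
have E : (T j.-1 - T e0 + (T j - prev_time T j) = T j - T e0)%R.
  by case: (j) hj => // j' _ /=; lra.
rewrite /= -E.
apply: (@PathStep _ _ _ _ _ _ _ _ _ (Some (dst j, Some (Some (new (l e0)))), l j, false,
  Some None, false, Some (dst j.+1, Some (Some (new (l e0))))) hx) => //.
- rewrite inE (out_edges_mem (d := dst j) (l := l j) (ph := Some (Some (new (l e0))))) ?orbT //.
  by rewrite /out_edges ha inE eqxx.
- by rewrite ok.
- by rewrite E /=; apply: hT; rewrite hj /=.
Qed.

Lemma path_watch e0 j : e0 < j <= e -> l e0 = watch nr ->
  (forall i, e0 < i < j -> l i != watch nr) ->
  path j (Some (dst j, Some None)) (T j.-1 - T e0)%R.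
Proof.
elim: j => // j IH /andP[hj je] hw hT; have [hd ha] := dstP (ltnW je).
move: hj; rewrite ltnS leq_eqVlt => /orP[/eqP ej|hj].
  subst j; have [x hx] := path_plain (ltnW je); rewrite /= Rminus_diag.
  apply: (@PathStep _ _ _ _ _ _ _ _ _ (Some (dst e0, None), l e0, false, None, true,
    Some (dst e0.+1, Some None)) hx) => //; last by rewrite ok.
  rewrite inE (out_edges_mem (d := dst e0) (l := l e0) (ph := None)) ?orbT //.
  by rewrite /out_edges ha hw eqxx !mem_cat !inE eqxx !orbT.
have hx := IH _ hw _; have {hx} hx : path j (Some (dst j, Some None)) (T j.-1 - T e0)%R.
  by apply: hx => [|i /andP[h1 h2]]; [rewrite hj ltnW | apply: hT; rewrite h1 /= ltnW].
have E : (T j.-1 - T e0 + (T j - prev_time T j) = T j - T e0)%R.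
  by case: (j) hj => // j' _ /=; lra.
rewrite /= -E.
apply: (@PathStep _ _ _ _ _ _ _ _ _ (Some (dst j, Some None), l j, false,
  None, false, Some (dst j.+1, Some None)) hx) => //; last by rewrite ok.
rewrite inE (out_edges_mem (d := dst j) (l := l j) (ph := Some None)) ?orbT //.
by rewrite /out_edges ha (negbTE (hT j _)) ?inE ?eqxx // hj /=.
Qed.

Lemma caught_blank : old (l e) = ord0 -> l e != expire nr -> b e ->
  exists x, path e.+1 (sink nr) x.
Proof.
move=> o0 le be; have [hd ha] := dstP (leqnn e); have [x hx] := path_plain (leqnn e).
eexists; apply: (@PathStep _ _ _ _ _ _ _ _ _ (Some (dst e, None), l e, true, None, false,
  sink nr) hx) => //.
rewrite inE (out_edges_mem (d := dst e) (l := l e) (ph := None)) ?orbT //.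
by rewrite /out_edges ha o0 eqxx le !mem_cat !inE eqxx !orbT.
Qed.

Lemma caught_guess e0 : e0 < e -> old (l e) != ord0 -> b e = (old (l e) == new (l e0)) ->
  (forall i, e0 < i < e -> (0 < T i - T e0 < 1)%R) -> (T e - T e0 = 1)%R ->
  exists x, path e.+1 (sink nr) x.
Proof.
move=> he o0 be hT hTe; have [hd ha] := dstP (leqnn e).
have hx : path e (Some (dst e, Some (Some (new (l e0))))) (T e.-1 - T e0)%R.
  by apply: path_guess => //; rewrite he /=.
eexists; apply: (@PathStep _ _ _ _ _ _ _ _ _ (Some (dst e, Some (Some (new (l e0)))), l e,
  old (l e) == new (l e0), Some (Some 1), false, sink nr) hx) => //.
- rewrite inE (out_edges_mem (d := dst e) (l := l e) (ph := Some (Some (new (l e0))))) ?orbT //.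
  by rewrite /out_edges ha (negbTE o0) !inE eqxx orbT.
- by case: (e) he hTe => // e' _ /= ?; lra.
Qed.

Lemma caught_watch e0 : e0 < e -> l e = expire nr -> l e0 = watch nr -> b e ->
  (forall i, e0 < i < e -> l i != watch nr) -> (T e - T e0 = INR n)%R ->
  exists x, path e.+1 (sink nr) x.
Proof.
move=> he le lw be hT hTe; have [hd ha] := dstP (leqnn e).
have hx : path e (Some (dst e, Some None)) (T e.-1 - T e0)%R.
  by apply: path_watch => //; rewrite he /=.
have dE : dst e = Load0 by move: ha; rewrite le /=; case: (dst e).
rewrite dE in hx.
eexists; apply: (@PathStep _ _ _ _ _ _ _ _ _ (expire_edge nr n) hx) => //.
- by rewrite inE eqxx.
- by case: (e) he hTe => // e' _ /= ?; lra.
Qed.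

End Paths.

(** * Words without false claims *)

Section Honest.
Variables (nr : nat) (q : program) (n P : nat).
Implicit Types (w : seq (letter nr)) (D : phase).

Local Notation at_ w i := (nth (blank nr) w i).

Fixpoint runs D w D' : Prop :=
  if w is l :: w' then D \in phases q /\ exists2 D1, advance q D l = Some D1 & runs D1 w' D'
  else D = D'.

Lemma runs_cat D w1 D1 w2 D2 : runs D w1 D1 -> runs D1 w2 D2 -> runs D (w1 ++ w2) D2.
Proof. by elim: w1 D => [|l w1 IH] D /= => [->//|[h [D' a r]] r2]; split=> //; exists D'; auto. Qed.

Lemma runs_states D w D' : runs D w D' -> exists dst, [/\ dst 0 = D, dst (size w) = D' &
  forall i, i < size w -> dst i \in phases q /\ advance q (dst i) (at_ w i) = Some (dst i.+1)].
Proof.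
elim: w D => [|l w IH] D /=; first by move->; exists (fun _ => D').
case=> hD [D1 ha /IH[dst [d0 dn hd]]]; exists (fun i => if i is i'.+1 then dst i' else D).
by split=> // -[|i] hi /=; [rewrite d0 | apply: hd].
Qed.

(** Letter i will be played at time i/P, so the event one time unit ago is P positions back. *)
Definition legit w := forall i, i < size w -> old (at_ w i) != ord0 ->
  P <= i /\ new (at_ w (i - P)) = old (at_ w i).

Definition timed w := forall i, i < size w -> at_ w i = expire nr ->
  exists j, [/\ i = j + n * P, at_ w j = watch nr &
    forall j', j < j' < i -> at_ w j' != watch nr].

End Honest.

(** * Honest and late plays against a controller with k clocks *)

Section Spoiler.
Variables (nr : nat) (q : program) (n P k m : nat).
Variable C : controller #|{: letter nr}| 2 k m.
Hypothesis C_wins : winning C (accepts (reduction nr q n).2).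
Variables (w : seq (letter nr)) (D : phase).
Hypotheses (P_gt1 : 1 < P) (n_gt0 : 0 < n).
Hypotheses (w_runs : runs q Start w D) (w_legit : legit P w) (w_timed : timed n P w).

Local Notation at_ i := (nth (blank nr) w i).

Let a i : 'I_#|{: letter nr}| := enum_rank (at_ i).
Let grid i : R := (INR i / INR P)%R.

Let P_pos : (0 < INR P)%R. Proof. by apply: lt_0_INR; lia. Qed.

Lemma grid_le i j : i <= j -> (grid i <= grid j)%R.
Proof.
move=> ij; apply: Rmult_le_compat_r; first by left; apply: Rinv_0_lt_compat.
by apply: le_INR; lia.
Qed.

Lemma grid_lt i j : i < j -> (grid i < grid j)%R.
Proof.
move=> ij; apply: Rmult_lt_compat_r; first exact: Rinv_0_lt_compat.
by apply: lt_INR; lia.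
Qed.

Lemma grid0 : grid 0 = 0%R. Proof. by rewrite /grid /=; lra. Qed.

Lemma gridD i j : grid (i + j * P) = (grid i + INR j)%R.
Proof. by rewrite /grid plus_INR mult_INR; field; lra. Qed.

Lemma gridDP i : grid (i + P) = (grid i + 1)%R.
Proof. by rewrite -[in LHS](mul1n P) gridD. Qed.

(** The first objection in an honest play is wrong, and one of the three kinds of runs above catches
    it; being the first, it leaves all earlier answers silent, as those runs require. *)
Lemma honest_ok e : e < size w -> ctrl_answer C a grid e != 1 :> nat.
Proof.
elim/ltn_ind: e => e IH he; apply/negP => be.
have [dst [d0 _ hd]] := runs_states w_runs.
have gT : (R0 <= grid 0)%R by rewrite grid0; lra.
have gI i : (grid i <= grid i.+1)%R by apply: grid_le.
apply: (@C_wins a grid gT gI).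
pose b i := ctrl_answer C a grid i == 1 :> nat.
have dP i : i <= e -> dst i \in phases q /\ advance q (dst i) (at_ i) = Some (dst i.+1).
  by move=> hi; apply: hd; apply: leq_ltn_trans he.
have bF i : i < e -> b i = false.
  by move=> hi; apply/negbTE; apply: IH => //; apply: ltn_trans he.
suff [x hx] : exists x, path_to q n (fun i => at_ i) b grid e.+1 (sink nr) x.
  apply: accepts_path gT gI hx => i.
  by rewrite play_word /code_word /a enum_rankK.
have [o0|o0] := eqVneq (old (at_ e)) ord0.
  have [le|le] := eqVneq (at_ e) (expire nr); last exact: (caught_blank n grid d0 dP bF).
  have [j [ej jw hj]] := w_timed he le.
  have je : j < e by rewrite ej -[X in X < _]addn0 ltn_add2l muln_gt0 n_gt0; lia.
  apply: (caught_watch d0 dP bF je) => //.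
  by rewrite [in grid e]ej gridD; lra.
have [Pe hn] := w_legit he o0.
apply: (@caught_guess _ _ _ _ _ _ _ _ d0 dP bF (e - P)) => //; first lia.
- by rewrite /b be hn eqxx.
- move=> i /andP[h1 h2]; have := grid_lt h1; have := grid_lt h2.
  by rewrite -[in grid e](subnK Pe) gridDP; lra.
- by rewrite -[in grid e](subnK Pe) gridDP; lra.
Qed.

(** The play pauses for one grid step before letter [e], whose exact predecessor thereby becomes
    letter [e.+1 - P]. *)
Let late e i : R := if i < e then grid i else grid i.+1.

Lemma ctrl_state_eq t t' i : (forall j, j < i -> t j = t' j) ->
  ctrl_state C a t i = ctrl_state C a t' i.
Proof.
elim: i => //= i IH h; rewrite IH; last by move=> j hj; apply: h; apply: ltnW.
have -> : prev_time t i = prev_time t' i by case: (i) h => //= i' h; apply: h.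
by rewrite h.
Qed.

(** Up to [e] the play is the honest one, so there was no objection yet; silence at [e] would accept
    a token although the letter one unit earlier left a blank. *)
Lemma late_caught e : e < size w -> P <= e.+1 -> old (at_ e) != ord0 ->
  new (at_ (e.+1 - P)) = ord0 -> ctrl_answer C a (late e) e == 1 :> nat.
Proof.
move=> he Pe o0 n0; apply/negPn/negP => be.
have [dst [d0 _ hd]] := runs_states w_runs.
have gT : (R0 <= late e 0)%R.
  by rewrite /late; case: ifP => _; rewrite -[R0]/(0%R) -grid0; apply: grid_le.
have gI i : (late e i <= late e i.+1)%R.
  by rewrite /late; case: ifP => h1; case: ifP => h2; apply: grid_le; lia.
apply: (@C_wins a (late e) gT gI).
pose b i := ctrl_answer C a (late e) i == 1 :> nat.
have dP i : i <= e -> dst i \in phases q /\ advance q (dst i) (at_ i) = Some (dst i.+1).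
  by move=> hi; apply: hd; apply: leq_ltn_trans he.
have bF i : i < e -> b i = false.
  move=> hi; apply/negbTE; have := honest_ok (ltn_trans hi he).
  have E : ctrl_state C a (late e) i = ctrl_state C a grid i.
    by apply: ctrl_state_eq => j hj; rewrite /late (ltn_trans hj hi).
  have Ei : late e i = grid i by rewrite /late hi.
  have Ep : prev_time (late e) i = prev_time grid i.
    by case: (i) hi => //= i' hi; rewrite /late (ltnW hi).
  by rewrite /b /ctrl_answer E Ei Ep.
suff [x hx] : exists x, path_to q n (fun i => at_ i) b (late e) e.+1 (sink nr) x.
  apply: accepts_path gT gI hx => i.
  by rewrite play_word /code_word /a enum_rankK.
have e0e : e.+1 - P < e by lia.
have lE : late e e = (grid (e.+1 - P) + 1)%R by rewrite /late ltnn -gridDP subnK.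
apply: (@caught_guess _ _ _ _ _ _ _ _ d0 dP bF (e.+1 - P)) => //.
- by rewrite n0 (negbTE o0) /b (negbTE be).
- move=> i /andP[h1 h2]; rewrite /late h2 e0e.
  have := grid_lt h1; have := grid_lt (leqW h2); have := lE; rewrite /late ltnn; lra.
- by rewrite lE /late e0e; lra.
Qed.

(** The default 0 is correct for a clock never reset: all clocks are 0 at time [grid 0]. *)
Fixpoint last_reset (i : nat) (x : 'I_k) : nat :=
  if i is i'.+1 then
    let: (c, mu) := ctrl_state C a grid i' in
    let nu := fun x => Rplus (mu x) (Rminus (grid i') (prev_time grid i')) in
    if x \in (@c_delta _ _ _ _ C c (a i') nu).2 then i' else last_reset i' x
  else 0.

Lemma last_reset_lt i x : last_reset i x <= i.-1.
Proof.
elim: i => //= i IH; case: (ctrl_state C a grid i) => c mu; case: ifP => // _.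
exact: leq_trans IH (leq_pred _).
Qed.

Lemma last_reset_stable i j x : i <= j -> last_reset j x < i -> last_reset i x = last_reset j x.
Proof.
elim: j => [|j IH]; first by rewrite leqn0 => /eqP->.
rewrite leq_eqVlt => /orP[/eqP->//|]; rewrite ltnS => ij /=.
case: (ctrl_state C a grid j) => c mu; case: ifP => _ h; last exact: IH.
by move: h; rewrite ltnNge ij.
Qed.

Lemma clock_reset i x : (ctrl_state C a grid i).2 x = (prev_time grid i - grid (last_reset i x))%R.
Proof.
elim: i => [|i IH] /=; first by rewrite grid0 -[R0]/(0%R); lra.
case: (ctrl_state C a grid i) IH => c mu /= IH.
case: (c_delta _ _ _) => [[c' b'] Y] /=; case: ifP => _; first by rewrite Rminus_diag.
by rewrite IH; lra.
Qed.

(* If a clock valuation stays strictly between two integers during a delay of one grid step, the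
   controller cannot distinguish an honest event from one that is one step late. *)
Lemma clock_near e : e < size w -> P <= e.+1 -> old (at_ e) != ord0 ->
  new (at_ (e.+1 - P)) = ord0 ->
  exists x, (P %| e - last_reset e x) || (P %| e.+1 - last_reset e x).
Proof.
move=> he Pe o0 n0.
case: (pickP (fun x => (P %| e - last_reset e x) || (P %| e.+1 - last_reset e x))) => [x hx|hN].
  by exists x.
have e_gt0 : 0 < e by lia.
have := honest_ok he; have := late_caught he Pe o0 n0.
have E : ctrl_state C a (late e) e = ctrl_state C a grid e.
  by apply: ctrl_state_eq => j hj; rewrite /late hj.
have Ep : prev_time (late e) e = prev_time grid e.
  by case: (e) e_gt0 => //= e' _; rewrite /late ltnSn.
have lr x : last_reset e x < e by have := last_reset_lt e x; lia.
rewrite /ctrl_answer E Ep; have := clock_reset e.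
case: (ctrl_state C a grid e) => c mu /= hmu.
rewrite (_ : c_delta c (a e) _ = c_delta c (a e) (fun x => mu x + (grid e - prev_time grid e))%R).
  by move=> /eqP-> /eqP.
have lE : late e e = grid e.+1 by rewrite /late ltnn.
apply: c_delta_region => x y op z _; rewrite lE.
(* The two values are consecutive multiples of 1/P. By [hN] neither is an integer, so no integer
   separates them. *)
have ne x' z' : let A := (mu x' + (grid e.+1 - prev_time grid e))%R in
    let B := (mu x' + (grid e - prev_time grid e))%R in
    (A < int_to_R z' /\ B < int_to_R z' \/ int_to_R z' < A /\ int_to_R z' < B)%R.
  have BE : (mu x' + (grid e - prev_time grid e) = INR (e - last_reset e x') / INR P)%R.
    rewrite hmu minus_INR; last by have := lr x'; lia.
    by rewrite /grid; field; lra.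
  have AE : (mu x' + (grid e.+1 - prev_time grid e) = INR (e.+1 - last_reset e x') / INR P)%R.
    rewrite hmu minus_INR; last by have := lr x'; lia.
    by rewrite /grid; field; lra.
  rewrite /= AE BE.
  have pos i : (0 <= INR i / INR P)%R.
    by apply: Rmult_le_pos; [exact: pos_INR | left; apply: Rinv_0_lt_compat].
  case: z' => [c'|c']; last first.
    by right; have := pos (e - last_reset e x'); have := pos (e.+1 - last_reset e x');
      have := pos_INR c'; rewrite /int_to_R S_INR; lra.
  have cE : INR c' = (INR (c' * P) / INR P)%R by rewrite mult_INR; field; lra.
  rewrite /int_to_R cE.
  have lt i j : i < j -> (INR i / INR P < INR j / INR P)%R.
    move=> ij; apply: Rmult_lt_compat_r; first exact: Rinv_0_lt_compat.
    by apply: lt_INR; lia.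
  have := hN x' => /negbT; rewrite negb_or => /andP[n1 n2].
  have d1 : e - last_reset e x' != c' * P by apply: contraNneq n1 => ->; apply: dvdn_mull.
  have d2 : e.+1 - last_reset e x' != c' * P by apply: contraNneq n2 => ->; apply: dvdn_mull.
  have := lr x' => hl.
  case: (ltnP (e.+1 - last_reset e x') (c' * P)) => hc.
    by left; split; apply: lt => //; lia.
  by right; split; apply: lt; lia.
rewrite /csat; case: y => [y|].
  (* Diagonal constraints are insensitive to the delay. *)
  have -> : (mu x + (grid e.+1 - prev_time grid e) - (mu y + (grid e.+1 - prev_time grid e)) =
    mu x + (grid e - prev_time grid e) - (mu y + (grid e - prev_time grid e)))%R by lra.
  by [].
rewrite !Rminus_0_r; have /= := ne x z.
by case: op => -[|[|[|[|[|]]]]] // hop; rewrite /cmp_sat /=; lra.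
Qed.

(* More tokens than clocks: two tests of the same round would need the same clock. *)
Lemma too_many_tests base : P = k.+1.*2 + 2 -> P %| base -> P <= base ->
  (forall j, j <= k -> [/\ base + j.*2.+1 < size w, old (at_ (base + j.*2.+1)) != ord0 &
     new (at_ ((base + j.*2.+1).+1 - P)) = ord0]) -> False.
Proof.
move=> PE Pb Pbase H.
have hx (j : 'I_k.+1) : exists x, (P %| base + j.*2.+1 - last_reset (base + j.*2.+1) x) ||
    (P %| (base + j.*2.+1).+1 - last_reset (base + j.*2.+1) x).
  have [h1 h2 h3] := H j (ltn_ord j); apply: clock_near => //; lia.
pose f j := xchoose (hx j).
have key (j : 'I_k.+1) : exists c, last_reset base (f j) + c * P = base + j.*2.+1 \/
    last_reset base (f j) + c * P = (base + j.*2.+1).+1.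
  have := xchooseP (hx j); rewrite -/(f j); set r := last_reset _ (f j) => hr.
  have rlt : r < base + j.*2.+1 by rewrite /r; have := last_reset_lt (base + j.*2.+1) (f j); lia.
  have jk := ltn_ord j.
  (* A reset inside the current round lies more than 0 and fewer than P steps back, so neither
     distance is a multiple of P. *)
  have rb : r < base.
    rewrite ltnNge; apply/negP => br.
    case/orP: hr => /dvdnP[c hc]; case: c hc => [|c] hc; try lia;
      have : P <= c.+1 * P by [rewrite leq_pmull]; lia.
  rewrite (@last_reset_stable base (base + j.*2.+1) (f j)) // -/r; last by lia.
  case/orP: hr => /dvdnP[c hc]; exists c; [left|right]; lia.
(* A clock shared by two tests has one last reset before [base]; modulo P it would agree with an
   offset 2j+1 or 2j+2 of each test, but these pairs are disjoint and all lie below P. *)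
have inj : injective f.
  move=> j1 j2 e12; apply: val_inj => /=.
  have [c1 h1] := key j1; have [c2 h2] := key j2; rewrite -e12 in h2.
  have k1 := ltn_ord j1; have k2 := ltn_ord j2.
  case: (ltngtP c1 c2) => c12.
  - have : c1 * P + P <= c2 * P by rewrite -mulSnr leq_mul2r c12 orbT.
    lia.
  - have : c2 * P + P <= c1 * P by rewrite -mulSnr leq_mul2r c12 orbT.
    lia.
  - rewrite c12 in h1; lia.
by have := leq_card f inj; rewrite !card_ord ltnn.
Qed.

End Spoiler.

(** * Honest words *)

Section HonestWords.
Variables (nr : nat) (q : program) (n N : nat).
Hypotheses (nr_gt0 : 0 < nr) (n_gt0 : 0 < n) (q_regs : uses_regs nr q).
Implicit Types (w b : seq (letter nr)) (D : phase) (s : seq nat).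

Local Notation at_ w i := (nth (blank nr) w i).
Local Notation P := (N.*2 + 2).

Local Notation idn := (fun x : nat => x).

Definition mk (x y : nat) : letter nr := inl (inord x, inord y).

Definition valid s := all (fun x => 1 < x < nr.+3) s.

Lemma old_mk x y : x < nr.+3 -> old (mk x y) = x :> nat.
Proof. by move=> h; rewrite /= inordK. Qed.

(** A late letter is measured against the blank behind its true predecessor. *)
Definition spaced b := flatten [seq [:: l; blank nr] | l <- b].

Lemma size_spaced b : size (spaced b) = (size b).*2.
Proof. by elim: b => //= l b ->; rewrite doubleS. Qed.

Lemma nth_spaced b i : at_ (spaced b) i = if odd i then blank nr else at_ b i./2.
Proof.
elim: b i => [|l b IH] i; first by rewrite !nth_nil if_same.
by case: i => [|[|i]] //=; rewrite negbK IH.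
Qed.

(** One round: a place for [watch] or [expire], [N] places for tokens, and the mark that ends it.
    Padding gives all rounds the same length 2N+2. *)
Definition block (sp : letter nr) b : seq (letter nr) :=
  sp :: spaced (b ++ nseq (N - size b) (blank nr)) ++ [:: mk 1 1].

Lemma size_block sp b : size b <= N -> size (block sp b) = P.
Proof. by move=> h; rewrite /= size_cat size_spaced size_cat size_nseq subnKC //= addn1 addn2. Qed.

Lemma nth_block sp b i : size b <= N -> i < P -> at_ (block sp b) i =
  if i == 0 then sp else if i == P.-1 then mk 1 1 else if odd i then at_ b i./2 else blank nr.
Proof.
move=> hb; case: i => //= i hi; rewrite nth_cat size_spaced size_cat size_nseq subnKC //.
case: ltnP => hi'.
  rewrite ifF; last by lia.
  rewrite nth_spaced uphalf_half; case: (odd i) => //=; rewrite nth_cat add0n.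
  by case: ltnP => // h; rewrite nth_nseq if_same nth_default.
have -> : i = N.*2 by lia.
by rewrite subnn ifT //; lia.
Qed.

(* Token types left in the last [P] events, given the types [s] of the used chains. *)
Definition window s (i : nat) : nat :=
  if i == P.-1 then 1 else if odd i then nth 0 s i./2 else 0.

Record config_word w D s : Prop := ConfigWord {
  cw_runs : runs q Start w D;
  cw_phase : D \in phases q;
  cw_legit : legit P w;
  cw_timed : timed n P w;
  cw_dvd : P %| size w;
  cw_size : P <= size w;
  cw_window : forall i, i < P -> new (at_ w (size w - P + i)) = window s i :> nat;
  cw_chains : size s <= N;
  cw_valid : valid s
}.

(** The letter to be appended next comes exactly [i] rounds after the last start of the
    stopwatch. *)
Definition since_watch w i := exists e, [/\ size w = e + i * P, at_ w e = watch nr &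
  forall j, e < j < size w -> at_ w j != watch nr].

Lemma runs_blank D b D' : D' \in phases q -> runs q D b D' -> runs q D (spaced b) D'.
Proof.
move=> hD'; elim: b D => //= l b IH D [hD [D1 ha hr]]; split=> //; exists D1 => //.
split; first by case: b hr {IH} => [->|l' b []].
by exists D1 => //; apply: IH.
Qed.

Lemma runs_const D b : D \in phases q -> all (fun l => advance q D l == Some D) b -> runs q D b D.
Proof. by move=> hD; elim: b => //= l b IH /andP[/eqP ha hb]; split=> //; exists D; auto. Qed.

(** Position j of the new block looks back at position j of the last window, so it suffices that the
    claims of [b] agree entrywise with [s]. *)
Lemma next_word w D s sp D1 b D2 D' :
  config_word w D s -> advance q D sp = Some D1 -> old sp = ord0 -> new sp = ord0 ->
  runs q D1 b D2 -> D2 \in phases q -> next_round q D2 = Some D' -> D' \in phases q ->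
  size b <= N -> all (fun l => if l is inl _ then 1 < new l else false) b ->
  (forall j, old (at_ b j) != ord0 -> old (at_ b j) = nth 0 s j :> nat) ->
  (sp = expire nr -> since_watch w n) ->
  let w' := w ++ block sp b in
  [/\ config_word w' D' (map (fun l => new l : nat) b),
      sp = watch nr -> since_watch w' 1 &
      sp <> watch nr -> forall i, since_watch w i -> since_watch w' i.+1].
Proof.
move=> cw ha so sn hr hD2 hn hD' hb bn bo hexp w'.
have sB := size_block sp hb.
have sw' : size w' = size w + P by rewrite /w' size_cat sB.
have lo i : i < size w -> at_ w' i = at_ w i by move=> hi; rewrite /w' nth_cat hi.
have hi i : i < P -> at_ w' (size w + i) = at_ (block sp b) i.
  by move=> _; rewrite /w' nth_cat ltnNge leq_addr /= addKn.
have inlb j : at_ b j = blank nr \/ exists x y, at_ b j = inl (x, y) /\ 1 < y.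
  case: (ltnP j (size b)) => hj; last by left; rewrite nth_default.
  have := all_nthP (blank nr) bn j hj; case: (at_ b j) => // -[x y] h.
  by right; exists x, y.
have bnw j : at_ b j != watch nr by case: (inlb j) => [->|[x [y [-> _]]]].
have bne j : at_ b j != expire nr by case: (inlb j) => [->|[x [y [-> _]]]].
have hi_watch i : 0 < i < P -> at_ w' (size w + i) != watch nr.
  case/andP=> i0 iP; rewrite hi // nth_block // ifF; last by lia.
  by do 2 case: ifP => // _.
split; first split.
- have hw := cw_runs cw; apply: runs_cat hw _; rewrite /block /=; split; first exact: cw_phase cw.
  exists D1 => //; apply: runs_cat (_ : runs q D1 _ D2) _.
    apply: runs_blank => //; apply: runs_cat hr _; apply: runs_const => //.
    by apply/allP => l /nseqP[-> _] /=.
  by split=> //; exists D' => //=; rewrite !inordK.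
- by [].
- move=> i; rewrite sw' => iw; case: (ltnP i (size w)) => iw'.
    by rewrite (lo i) // (lo (i - P)); [exact: (cw_legit cw iw') | lia].
  have := subnKC iw'; set j := i - size w => ij; have jP : j < P by lia.
  have sP := cw_size cw.
  rewrite -ij hi // => h0; split; first by lia.
  have -> : size w + j - P = size w - P + j by lia.
  rewrite lo; last by lia.
  apply: val_inj => /=; rewrite (cw_window cw) //.
  move: h0; rewrite nth_block //; case: (j =P 0) => [_|j0]; first by rewrite so.
  rewrite /window; case: (j =P P.-1) => [_ _|j1]; first by rewrite /= inordK.
  by case: ifP => // jo h0; rewrite bo.
- move=> i; rewrite sw' => iw; case: (ltnP i (size w)) => iw'.
    rewrite lo // => /(cw_timed cw iw')[j [ij jw hj]].
    have ji : j <= i by rewrite ij leq_addr.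
    exists j; split=> //; first by rewrite lo //; lia.
    by move=> j' hj'; rewrite lo ?hj //; lia.
  have := subnKC iw'; set j := i - size w => ij; have jP : j < P by lia.
  rewrite -ij hi // nth_block //; case: (j =P 0) => [j0 se|j0].
    have [e [se' ew he]] := hexp se.
    exists e; rewrite j0 addn0 se'; split=> //.
      by rewrite lo // se' -[X in X < _]addn0 ltn_add2l muln_gt0 n_gt0; lia.
    move=> j' hj'; rewrite lo ?he ?se' //; lia.
  case: (j =P P.-1) => // j1; case: ifP => // jo h; by have := bne j./2; rewrite h eqxx.
- by rewrite sw' dvdn_addl // (cw_dvd cw).
- by rewrite sw' leq_addl.
- move=> i iP; rewrite sw' addnK hi // nth_block // /window.
  case: (i =P 0) => [->|i0]; first by rewrite ifF ?sn //; lia.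
  case: (i =P P.-1) => [_|i1]; first by rewrite /= inordK.
  case: ifP => // io; case: (ltnP i./2 (size b)) => h; first by rewrite (nth_map (blank nr)).
  by rewrite !nth_default // size_map.
- by rewrite size_map.
- rewrite /valid all_map; apply: sub_all bn => l /=.
  by case: l => // -[x y] /= ->; rewrite ltn_ord.
- move=> se; exists (size w); rewrite sw' mul1n -[X in at_ _ X]addn0 hi //; last by lia.
  split=> // j /andP[h1 h2]; rewrite -(subnKC (ltnW h1)); apply: hi_watch; lia.
- move=> se i [e [h1 h2 h3]]; have eW : e < size w.
    rewrite ltnNge; apply/negP => h; move: h2; rewrite nth_default //.
  exists e; rewrite sw' h1 mulSn; split; [lia | by rewrite lo |].
  move=> j /andP[j1 j2]; case: (ltnP j (size w)) => jw; first by rewrite lo // h3 // j1.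
  rewrite -(subnKC jw); case: (posnP (j - size w)) => j0.
    by rewrite j0 hi ?nth_block //=; [apply/eqP | lia | lia].
  by apply: hi_watch; lia.
Qed.

Lemma start_word : exists w, config_word w Grow0 [::].
Proof.
(* Blanks fill up a whole round before the first mark. *)
exists (nseq P.-1 (blank nr) ++ [:: mk 0 1]).
have sw : size (nseq P.-1 (blank nr) ++ [:: mk 0 1]) = P.
  by rewrite size_cat size_nseq /=; lia.
have at_i i : i < P -> at_ (nseq P.-1 (blank nr) ++ [:: mk 0 1]) i =
    if i == P.-1 then mk 0 1 else blank nr.
  move=> iP; rewrite nth_cat size_nseq; case: ltnP => h.
    by rewrite nth_nseq h ifF //; lia.
  have -> : i = P.-1 by lia.
  by rewrite subnn eqxx.
split=> //; rewrite ?sw //.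
- apply: runs_cat (_ : runs q Start _ Start) _.
    by apply: runs_const => //; apply/allP => l /nseqP[-> _].
  by split=> //; exists Grow0 => //=; rewrite !inordK.
- move=> i; rewrite sw => iP; rewrite at_i //; case: ifP => // _ /eqP[].
  by apply: val_inj; rewrite /= inordK.
- by move=> i; rewrite sw => iP; rewrite at_i //; case: ifP.
- move=> i iP; rewrite subnn add0n at_i // /window; case: ifP => // _.
    by rewrite /= inordK.
  by rewrite nth_nil if_same.
Qed.

Lemma advance_copy D x y : 1 < x < nr.+3 -> y < nr.+3 -> copies q D x = Some y ->
  (forall x' y' D', change q D = Some (x', y', D') -> x' != x) -> advance q D (mk x y) = Some D.
Proof.
move=> /andP[x1 xn] yn hc hch; rewrite /= !inordK // x1 hc eqxx /=.
rewrite (_ : x == 0 = false) /=; last by lia.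
rewrite (_ : x == 1 = false) /=; last by lia.
case E : (change q D) => [[[x' y'] D']|] //; rewrite eq_sym (negbTE (hch _ _ _ E)) //.
Qed.

Lemma advance_change D x y D' : 1 < x < nr.+3 -> y < nr.+3 -> change q D = Some (x, y, D') ->
  advance q D (mk x y) = Some D'.
Proof.
move=> /andP[x1 xn] yn hc; rewrite /= !inordK // hc !eqxx /=.
rewrite (_ : x == 0 = false) /=; last by lia.
by rewrite (_ : x == 1 = false) /=; last by lia.
Qed.

Lemma map_new_mk (f g : nat -> nat) s : (forall x, x \in s -> g x < nr.+3) ->
  map (fun l => new l : nat) [seq mk (f x) (g x) | x <- s] = map g s.
Proof. by move=> h; rewrite -map_comp; apply/eq_in_map => x /h hx; rewrite /= inordK. Qed.

Lemma validP s x : valid s -> x \in s -> 1 < x < nr.+3. Proof. by move/allP; apply. Qed.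

Lemma all_mk (f g : nat -> nat) s : (forall x, x \in s -> 1 < g x < nr.+3) ->
  all (fun l => if l is inl _ then 1 < new l else false) [seq mk (f x) (g x) | x <- s].
Proof.
move=> h; rewrite all_map; apply/allP => x /h /andP[h1 h2]; rewrite /= inordK //.
Qed.

Lemma old_nth_mk (g : nat -> nat) s j : valid s -> old (at_ [seq mk x (g x) | x <- s] j) = nth 0 s j :> nat.
Proof.
move=> vs; case: (ltnP j (size s)) => hj; last by rewrite !nth_default // size_map.
by rewrite (nth_map 0) // old_mk //; case/andP: (validP vs (mem_nth 0 hj)).
Qed.

Lemma idle_round w D s sp D1 D' :
  config_word w D s -> advance q D sp = Some D1 -> old sp = ord0 -> new sp = ord0 ->
  sp <> watch nr -> (sp = expire nr -> since_watch w n) ->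
  D1 \in phases q -> next_round q D1 = Some D' -> D' \in phases q ->
  (forall x, x \in s -> copies q D1 x = Some x /\
     forall x' y' D2, change q D1 = Some (x', y', D2) -> x' != x) ->
  exists2 w', config_word w' D' s & forall i, since_watch w i -> since_watch w' i.+1.
Proof.
move=> cw ha so sn sw se hD1 hn hD' hc; have vs := cw_valid cw.
have [|||||cw' _ h] := @next_word w D s sp D1 [seq mk x x | x <- s] D1 D' cw ha so sn _ hD1 hn hD'.
- apply: runs_const => //; rewrite all_map; apply/allP => x xs /=.
  have [h1 h2] := hc x xs; have /andP[v1 v2] := validP vs xs.
  by apply/eqP; apply: advance_copy => //; rewrite v1 v2.
- by rewrite size_map (cw_chains cw).
- by apply: (all_mk idn) => x /(validP vs).
- by move=> j _; rewrite (old_nth_mk idn).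
- exact: se.
rewrite (map_new_mk idn (g := idn)) ?map_id in cw'; last by move=> x /(validP vs)/andP[].
by eexists; [exact: cw' | exact: h].
Qed.

Lemma change_round w D s1 x s2 y sp D1 D2 D' :
  config_word w D (s1 ++ x :: s2) -> advance q D sp = Some D1 -> old sp = ord0 -> new sp = ord0 ->
  sp <> watch nr -> (sp = expire nr -> since_watch w n) ->
  x \notin s1 -> 1 < y < nr.+3 ->
  D1 \in phases q -> D2 \in phases q -> next_round q D2 = Some D' -> D' \in phases q ->
  change q D1 = Some (x, y, D2) -> (forall v, v != x -> copies q D1 v = Some v) ->
  change q D2 = None -> (forall v, copies q D2 v = Some v) ->
  exists2 w', config_word w' D' (s1 ++ y :: s2) &
    forall i, since_watch w i -> since_watch w' i.+1.
Proof.
move=> cw ha so sn sw se xs1 y1 hD1 hD2 hn hD' hch hc1 hch2 hc2; have vs := cw_valid cw.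
have vx : 1 < x < nr.+3 by apply: (validP vs); rewrite mem_cat mem_head orbT.
have v1 v : v \in s1 -> 1 < v < nr.+3 by move=> h; apply: (validP vs); rewrite mem_cat h.
have v2 v : v \in s2 -> 1 < v < nr.+3.
  by move=> h; apply: (validP vs); rewrite mem_cat inE h !orbT.
pose b := [seq mk v v | v <- s1] ++ mk x y :: [seq mk v v | v <- s2].
have [|||||cw' _ h] := @next_word w D _ sp D1 b D2 D' cw ha so sn _ hD2 hn hD'.
- apply: runs_cat (_ : runs q D1 _ D1) _.
    apply: runs_const => //; rewrite all_map; apply/allP => v vs1 /=.
    apply/eqP; apply: advance_copy; rewrite ?hc1 ?v1 //.
    + by case/andP: (v1 v vs1).
    + by apply: contraNneq xs1 => <-.
    + by move=> x' y' D3; rewrite hch => -[<- _ _]; apply: contraNneq xs1 => ->.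
  split=> //; exists D2; first by apply: advance_change => //; case/andP: y1.
  apply: runs_const => //; rewrite all_map; apply/allP => v vs2 /=.
  apply/eqP; apply: advance_copy; rewrite ?hc2 ?v2 ?hch2 //.
  by case/andP: (v2 v vs2).
- by have := cw_chains cw; rewrite !size_cat /= !size_map.
- rewrite all_cat /= (all_mk idn (g := idn)) // inordK; last by case/andP: y1.
  by case/andP: y1 => -> _ /=; apply: (all_mk idn (g := idn)).
- move=> j _; rewrite /b !nth_cat size_map; case: ifP => _.
    by rewrite (old_nth_mk idn) //; apply/allP.
  case: (j - size s1) => [|j'] /=; first by rewrite inordK; case/andP: vx.
  by rewrite (old_nth_mk idn) //; apply/allP.
- exact: se.
eexists; last exact: h.
move: cw'; rewrite /b map_cat /= inordK; last by case/andP: y1.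
rewrite !(map_new_mk idn (g := idn)) ?map_id //; first by move=> v /v2/andP[].
by move=> v /v1/andP[].
Qed.

Lemma grow_round w s : config_word w Grow0 s -> size s < N ->
  exists2 w', config_word w' Load0 (nseq (size s).+1 2) & since_watch w' 1.
Proof.
move=> cw sN; have vs := cw_valid cw.
pose b := [seq mk v 2 | v <- s] ++ [:: mk 0 2].
have [|||||cw' h _] := @next_word w _ _ (watch nr) Grow1 b Grow2 Load0 cw erefl erefl erefl _
  isT erefl isT.
- apply: runs_cat (_ : runs q Grow1 _ Grow1) _.
    apply: runs_const => //; rewrite all_map; apply/allP => v /(validP vs) hv.
    apply/eqP; apply: (@advance_copy Grow1 v 2) => //.
    by move=> x' y' D' [<- _ _]; case/andP: hv; case: (v).
  by split=> //; exists Grow2 => //=; rewrite !inordK.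
- by rewrite size_cat size_map /= addn1.
- by rewrite all_cat (all_mk idn (g := fun _ => 2)) //= inordK.
- move=> j; rewrite nth_cat size_map; case: ifP => _; first by rewrite (old_nth_mk (fun _ => 2)).
  case: (j - size s) => [|[|j']] //= /eqP[].
  by apply: val_inj; rewrite /= inordK.
- by [].
exists (w ++ block (watch nr) b); last exact: h.
move: cw'; rewrite map_cat (map_new_mk idn (g := fun _ => 2)) //= inordK //.
suff -> : [seq 2 | _ <- s] ++ [:: 2] = 2 :: nseq (size s) 2 by [].
by elim: (s) => //= x s' ->.
Qed.

Lemma nseq_shift T (x y : T) i j : nseq i x ++ x :: nseq j y = nseq i.+1 x ++ nseq j y.
Proof. by elim: i => //= i ->. Qed.

(** One token is loaded per round while free ones remain; afterwards idle rounds carry the stopwatch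
    on to n. The n-th token is left to [LoadLast]. *)
Lemma load_rounds i T : 0 < i <= n -> forall w a c, a + c = T -> a = minn i.-1 T ->
  config_word w Load0 (nseq a 3 ++ nseq c 2) -> since_watch w i ->
  exists w' a' c', [/\ a' + c' = T, a' = minn n.-1 T,
    config_word w' Load0 (nseq a' 3 ++ nseq c' 2) & since_watch w' n].
Proof.
case/andP=> i0; move=> /subnK; move: (n - i) => d; elim: d i i0 => [|d IH] i i0 hi w a c acT aE cw sw.
  by exists w, a, c; split=> //; rewrite -?hi.
case: c acT cw => [|c] acT cw.
  have [|||||||||w' cw' h] := idle_round (sp := blank nr) (D1 := Load0) (D' := Load0) cw; try by [].
    move=> x; rewrite cats0 => /nseqP[-> _] /=; split=> //.
    by move=> x' y' D2 [<- _ _].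
  apply: (IH i.+1 _ _ w' a 0 acT _ cw' (h _ sw)) => //; first by rewrite addnS -addSn.
  by rewrite /= aE; lia.
have [|||||||||||||||w' cw' h] := change_round (y := 3) (sp := blank nr) (D1 := Load0) (D2 := Load1) (D' := Load0) cw; try by [].
- by apply/negP => /nseqP[].
- by move=> v v2 /=; rewrite (negbTE v2).
rewrite nseq_shift in cw'.
apply: (IH i.+1 _ _ w' a.+1 c _ _ cw' (h _ sw)) => //; [by rewrite addnS -addSn | lia |].
by rewrite /=; lia.
Qed.

Lemma exec_phase pc : pc <= size q -> Exec pc \in phases q.
Proof. by move=> h; rewrite !mem_cat map_f ?orbT // mem_iota. Qed.

Lemma done_phase pc : pc <= size q -> Done pc \in phases q.
Proof. by move=> h; rewrite !mem_cat (map_f Done) ?orbT // mem_iota. Qed.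

Definition counts s (rg : regs) := forall r, r < nr -> count_mem r.+3 s = rg r.

Lemma sum_counts s : \sum_(r < nr) count_mem r.+3 s <= size s.
Proof.
elim: s => [|x s IH] /=; first by rewrite big1.
rewrite big_split /= -add1n leq_add //.
case: (pickP (fun r : 'I_nr => x == r.+3)) => [r /eqP xr|h]; last by rewrite big1 // => r _; rewrite h.
by rewrite (bigD1 r) //= xr eqxx big1 // => r' /eqP rr; case: eqP => // -[e]; case: rr; apply: val_inj.
Qed.

Lemma split_first (x : nat) s : x \in s -> exists s1 s2, s = s1 ++ x :: s2 /\ x \notin s1.
Proof.
move=> xs; exists (take (index x s) s), (drop (index x s).+1 s); split.
  by rewrite -{1}(cat_take_drop (index x s) s) (drop_nth x) ?index_mem // nth_index.
by rewrite in_take_leq ?ltnn // index_size.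
Qed.

Lemma load_word w s : config_word w Grow0 s -> size s < N ->
  exists w' s', size s' = (size s).+1 /\ (config_word w' Grow0 s' \/
    config_word w' (Exec 0) s' /\ counts s' (init_config n).2).
Proof.
move=> cw sN; have [w1 cw1 sw1] := grow_round cw sN.
have [||w2 [a [c [acT aE cw2 sw2]]]] := @load_rounds 1 (size s).+1 _ w1 0 (size s).+1 erefl _ cw1 sw1.
- by rewrite n_gt0.
- by rewrite min0n.
case: c acT cw2 => [|c] acT cw2.
  have [|||||||||w' cw' _] := idle_round (sp := expire nr) (D1 := LoadLast) (D' := Grow0) cw2; try by [].
    move=> x; rewrite cats0 => /nseqP[-> _] /=; split=> //.
    by move=> x' y' D2 [<- _ _].
  by exists w', (nseq a 3 ++ nseq 0 2); rewrite size_cat !size_nseq; split=> //; left.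
have [|||||||||||||||w' cw' h] := change_round (y := 3) (sp := expire nr) (D1 := LoadLast) (D2 := Done 0) (D' := Exec 0) cw2; try by [].
- by apply/negP => /nseqP[].
- exact: done_phase.
- by move=> v v2 /=; rewrite (negbTE v2).
exists w', (nseq a 3 ++ 3 :: nseq c 2); rewrite size_cat /= !size_nseq; split; first lia.
right; split=> // r hr; rewrite count_cat /= !count_nseq /=.
have an : a = n.-1 by lia.
by case: r {hr} => [|r] /=; lia.
Qed.

Lemma simulate w s k : (forall k, (iter k (step q) (init_config n)).1 < size q) ->
  config_word w (Exec 0) s -> counts s (init_config n).2 ->
  exists w' s', size s' = size s /\ (config_word w' Grow0 s' \/
    let c := iter k (step q) (init_config n) in config_word w' (Exec c.1) s' /\ counts s' c.2).
Proof.
move=> nh cw cs; elim: k => [|k [w1 [s1 [ss [cw1|[cw1 cs1]]]]]].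
- by exists w, s; split=> //; right.
- by exists w1, s1; split=> //; left.
have := nh k; have := nh k.+1; rewrite iterS.
case: (iter k _ _) cw1 cs1 => pc rg /= cw1 cs1 + hpc; rewrite hpc.
have ia : instr_at q pc = Some (nth (INC 0) q pc) by rewrite /instr_at hpc.
have := all_nthP (INC 0) q_regs pc hpc.
case: (nth (INC 0) q pc) ia => [r|r j] /= ia rR hpc'.
  case: (boolP (2 \in s1)) => [/split_first[t1 [t2 [sE nt]]]|n2].
    rewrite sE in cw1 cs1.
    have [|||||||||||||||w' cw' _] := change_round (y := r.+3) (sp := blank nr) (D1 := Exec pc)
      (D2 := Done pc.+1) (D' := Exec pc.+1) cw1; rewrite /= ?ia //.
    + exact: exec_phase (ltnW hpc).
    + exact: done_phase.
    + exact: exec_phase.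
    + by move=> v v2; rewrite (negbTE v2).
    exists w', (t1 ++ r.+3 :: t2); split; first by rewrite -ss sE !size_cat.
    right; split=> // r' hr'; have := cs1 r' hr'; rewrite !count_cat /= /update => <-.
    by rewrite eqSS eqSS eqSS [r == r']eq_sym; case: (r' =P r) => [->|] /=; have := cs1 r rR; rewrite ?count_cat /=; lia.
  have [|||||||||w' cw' _] := idle_round (sp := blank nr) (D1 := Exec pc) (D' := Grow0) cw1; rewrite /= ?ia //.
  + exact: exec_phase (ltnW hpc).
  + move=> x xs; have x2 : x != 2 by apply: contraNneq n2 => <-.
    by rewrite (negbTE x2); split=> // x' y' D2 [<- _ _]; rewrite eq_sym.
  by exists w', s1; split=> //; left.
case: (boolP (r.+3 \in s1)) => [/split_first[t1 [t2 [sE nt]]]|nr3].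
  rewrite sE in cw1 cs1.
  have rg1 := cs1 r rR; rewrite count_cat /= eqxx in rg1.
  have [m rm] : exists m, rg r = m.+1 by exists (rg r).-1; lia.
  rewrite rm /= in hpc' *.
  have [|||||||||||||||w' cw' _] := change_round (y := 2) (sp := blank nr) (D1 := Exec pc)
    (D2 := Done pc.+1) (D' := Exec pc.+1) cw1; rewrite /= ?ia //.
  + exact: exec_phase (ltnW hpc).
  + exact: done_phase.
  + exact: exec_phase.
  + by move=> v v2; rewrite (negbTE v2).
  exists w', (t1 ++ 2 :: t2); split; first by rewrite -ss sE !size_cat.
  right; split=> // r' hr'; have := cs1 r' hr'; rewrite !count_cat /= /update.
  by rewrite eqSS eqSS eqSS [r == r']eq_sym; case: (r' =P r) => [->|] /=; lia.
have r0 : rg r = 0 by rewrite -cs1 //; apply/eqP; rewrite -leqn0 leqNgt -has_count has_pred1.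
rewrite r0 /= in hpc' *.
have [|||||||||w' cw' _] := idle_round (sp := blank nr) (D1 := Exec pc) (D' := Exec j) cw1; rewrite /= ?ia //.
+ exact: exec_phase (ltnW hpc).
+ exact: exec_phase (ltnW hpc').
+ move=> x xs; have xr : x != r.+3 by apply: contraNneq nr3 => <-.
  by rewrite (negbTE xr); split=> // x' y' D2 [<- _ _]; rewrite eq_sym.
by exists w', s1; split=> //; right.
Qed.

Hypothesis q_unbounded : unbounded_run nr q n.

Lemma never_halts k : (iter k (step q) (init_config n)).1 < size q.
Proof.
rewrite ltnNge; apply/negP => h.
have [B hB] : bounded_run nr q n.
  apply: (@halted_bounded nr q n (iter k (step q) (init_config n)).2) h.
  by exists k; apply: surjective_pairing.
by have [i] := q_unbounded B; rewrite ltnNge hB.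
Qed.

(** The unbounded run at some step needs more register tokens than exist, so the honest simulation
    must run out of free tokens before, and it returns to [Grow0] with nothing lost. *)
Lemma cycle_word w s : config_word w Grow0 s -> size s < N ->
  exists w' s', config_word w' Grow0 s' /\ size s' = (size s).+1.
Proof.
move=> cw sN; have [w1 [s1 [ss [cw1|[cw1 cs1]]]]] := load_word cw sN.
  by exists w1, s1.
have [k hk] := q_unbounded (size s).+1.
have [w2 [s2 [ss2 [cw2|[_ cs2]]]]] := simulate k never_halts cw1 cs1.
  by exists w2, s2; rewrite ss2.
move: hk; rewrite /run_sum (eq_bigr (fun r : 'I_nr => count_mem r.+3 s2)).
  by rewrite ltnNge -ss -ss2 sum_counts.
by move=> r _; rewrite cs2.
Qed.

Lemma large_word j : j <= N -> exists w s, config_word w Grow0 s /\ size s = j.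
Proof.
elim: j => [|j IH] hj; first by have [w cw] := start_word; exists w, [::].
have [w [s [cw sj]]] := IH (ltnW hj); have [|w' [s' [cw' ss]]] := cycle_word cw; first by rewrite sj.
by exists w', s'; rewrite ss sj.
Qed.

(** Once [N] tokens exist, a single loading round re-enacts all of them; each re-enactment is a
    test, since its predecessor was followed by a blank. *)
Lemma test_word : 0 < N -> exists w base D, [/\ runs q Start w D, legit P w, timed n P w,
  P %| base /\ P <= base & forall j, j < N -> [/\ base + j.*2.+1 < size w,
    old (at_ w (base + j.*2.+1)) != ord0 & new (at_ w ((base + j.*2.+1).+1 - P)) = ord0]].
Proof.
move=> N0; have [|w [s [cw sN]]] := @large_word N.-1; first exact: leq_pred.
have [|w1 cw1 _] := grow_round cw; first by rewrite sN prednK.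
rewrite sN prednK // in cw1.
pose b := mk 2 3 :: nseq N.-1 (mk 2 2).
have sb : size b = N by rewrite /= size_nseq prednK.
have atb j : old (at_ b j) = (if j < N then 2 else 0) :> nat.
  case: ltnP => hj; last by rewrite nth_default // sb.
  case: j hj => [|j] hj /=; first by rewrite inordK.
  by rewrite nth_nseq ifT ?old_mk //; lia.
have [|||||cw2 _ _] := @next_word w1 Load0 _ (blank nr) Load0 b Load1 Load0 cw1 erefl erefl erefl _ isT erefl isT; try by [].
- split=> //; exists Load1; first by apply: advance_change.
  apply: runs_const => //; apply/allP => l /nseqP[-> _].
  by apply/eqP; apply: advance_copy.
- by rewrite sb.
- by rewrite /= inordK //= all_nseq /= inordK // orbT.
- by move=> j _; rewrite atb nth_nseq.
exists (w1 ++ block (blank nr) b), (size w1), Load0; split.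
- exact: cw_runs cw2.
- exact: cw_legit cw2.
- exact: cw_timed cw2.
- by split; [exact: cw_dvd cw1 | exact: cw_size cw1].
- move=> j hj; have P1 := cw_size cw1; rewrite size_cat size_block ?sb //; split; first lia.
    rewrite nth_cat ltnNge leq_addr /= addKn nth_block ?sb //; last lia.
    rewrite ifF; last lia.
    by rewrite /= odd_double /= uphalf_double -val_eqE /= atb hj.
  rewrite nth_cat ifT; last lia.
  have -> : (size w1 + j.*2.+1).+1 - P = size w1 - P + j.*2.+2 by lia.
  apply: val_inj; rewrite /= (cw_window cw1); last lia.
  rewrite /window ifF; last lia.
  by rewrite /= odd_double.
Qed.

End HonestWords.

Theorem unbounded_run_no_synth nr q n : 0 < nr -> 0 < n -> uses_regs nr q ->
  unbounded_run nr q n -> ~ synth_problem (reduction nr q n).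
Proof.
move=> nr0 n0 qr hu [k [m [C hC]]].
have [w [base [D [h1 h2 h3 [h4 h5] h6]]]] := test_word nr0 n0 qr hu (ltn0Sn k).
have P1 : 1 < k.+1.*2 + 2 by rewrite addn2.
exact: (too_many_tests hC P1 n0 h1 h2 h3 erefl h4 h5 h6).
Qed.

(** * Self-reference *)

Lemma pickle_pair (T1 T2 : countType) (x : T1) (y : T2) :
  pickle (x, y) = node (pickle x) (node (pickle y) 0).
Proof. by []. Qed.

Lemma pickle_cons (T : countType) (x : T) (s : seq T) :
  pickle (x :: s) = node (pickle x) (pickle s).
Proof. by []. Qed.

Lemma pickle_Posz k : pickle (Posz k) = node (node k 0) (node 0 0).
Proof. by []. Qed.

Definition epair (a b : expr) : expr := ENode a (ENode b (EConst 0)).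
Definition esingle (a : expr) : expr := ENode a (EConst 0).

(** The parameters are codes that depend on the number of registers only. [EVar] occurs twice: as
    the constant of the guard and as the code of the remaining rules. *)
Definition reduction_expr (alph init src op reset tgt : nat) : expr :=
  let int_e := ENode (esingle EVar) (esingle (EConst 0)) in
  let guard_e := esingle (esingle (epair (EConst op) int_e)) in
  let rule_e :=
    epair (epair (epair (EConst src) guard_e) (EConst reset)) (EConst tgt) in
  epair (EConst alph) (epair (EConst init) (ENode rule_e EVar)).

(** Constants add no depth, so the bound is known before the number of registers that determines
    them. *)
Lemma reduction_expr_depth a i s o r t : edepth (reduction_expr a i s o r t) <= 9.
Proof. by []. Qed.

Lemma pickle_reduction nr : exists a i s o r t, forall q,
  let n := pickle (rules nr q) in
  pickle (reduction nr q n) = eval n (reduction_expr a i s o r t).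
Proof.
exists (pickle (#|{: letter nr}|, 2)),
  (pickle ([:: location_code (Some (Start, None) : location nr)], [:: location_code (sink nr)])),
  (pickle (location_code (Some (Load0, Some None) : location nr), Some (letter_code (expire nr), 1))),
  (pickle (0, None : option nat, op_eq)), (pickle ([::] : seq nat)),
  (location_code (sink nr)) => q n.
rewrite /reduction (pickle_pair (_, _) (_, _)) (pickle_pair (_, _) (_ :: _)) pickle_cons.
rewrite /transition_of (pickle_pair (_, _, _, _)) (pickle_pair (_, _, _)) (pickle_pair (_, _)).
by rewrite !pickle_cons (pickle_pair (_, _, _)) pickle_Posz.
Qed.

Theorem synthesis_undecidable : ~ cm_decidable_on one_clock_no_eps synth_problem.
Proof.
move=> [p hp]; have [R R0 hR] := diagonal_program p 9.
have [a [i [s [o [r [t hpk]]]]]] := pickle_reduction R.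
have [q qr hq] := hR _ (reduction_expr_depth a i s o r t).
have := hpk q; set n := pickle (rules R q) => pE.
have n0 : 0 < n.
  rewrite /n; case E : (rules R q) => [|e es]; last by rewrite pickle_cons muln_gt0 expn_gt0.
  by have := map_f (@transition_of R) (sink_edge_mem q (blank R) false); rewrite -/(rules R q) E.
have [h1 h0] := hp _ (@reduction_one_clock R q n).
rewrite pE in h1 h0; have [hb hu] := hq n.
have no : ~ synth_problem (reduction R q n).
  by move=> hs; apply: (unbounded_run_no_synth R0 n0 qr (hu (h1 hs)) hs).
exact/no/(bounded_run_synth R0 n0 qr)/hb/h0.
Qed.

Theorem theorem15 :
  ~ cm_decidable synth_problem /\ ~ cm_decidable_on one_clock_no_eps synth_problem.
Proof.
split; last exact: synthesis_undecidable.
by move=> [p hp]; apply: synthesis_undecidable; exists p => x _; apply: hp.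
Qed.
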